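(* Suppose that Assumption A holds (see context) and that $\mathcal{F}_\lambda$ is a KL function with an exponent $\theta\in[0,1)$. Let $\{(X^k,Y^k)\}$ be the sequence generated by the A-NAUM algorithm (see context), and let $(\widetilde X,\widetilde Y)$ be its limit point (the whole sequence converges). Then the following statements hold for all sufficiently large $k$. (i) If $\theta\in[0,\frac12]$, there exist $d_1>0$ and $\varrho\in(0,1)$ such that $\|X^k-\widetilde X\|_F+\|Y^k-\widetilde Y\|_F\le d_1\varrho^k$. (ii) If $\theta\in(\frac12,1)$, there exists $d_2>0$ such that $\|X^k-\widetilde X\|_F+\|Y^k-\widetilde Y\|_F\le d_2k^{-\frac{1-\theta}{2\theta-1}}$. (The constants do not depend on $k$.)
   Context: **Setting.** $r\le n$, $q\le n^2$, $\bm{b}\in\mathbb{R}^q$, $\lambda\ge0$, $\mathcal{A}:\mathbb{R}^{n\times n}\to\mathbb{R}^q$ linear with adjoint $\mathcal{A}^*$; $\Psi,\Phi:\mathbb{R}^{n\times r}\to\mathbb{R}\cup\{+\infty\}$; $$\mathcal{F}_\lambda(X,Y):=\Psi(X)+\Phi(Y)+\tfrac12\|\mathcal{A}(XY^\top)-\bm{b}\|^2+\tfrac{\lambda}{2}\|X-Y\|_F^2,\quad X,Y\in\mathbb{R}^{n\times r}.$$ $\|\cdot\|$ is the Euclidean norm for vectors, spectral norm for matrices, operator norm for linear maps on $(\mathbb{R}^{n\times n},\|\cdot\|_F)$; $\mathcal{I}_q,\mathcal{I}$ are the identities on $\mathbb{R}^q$, $\mathbb{R}^{n\times n}$. Lowercase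 bold letters denote columns, e.g. $X=[\bm{x}_1,\dots,\bm{x}_r]$. Closed means lower semicontinuous; level-bounded means all sublevel sets are bounded. **Assumption A.** (i) $\Psi$ (or $\psi_i$ for all $i$ if $\Psi(X)=\sum_{i=1}^r\psi_i(\bm{x}_i)$) and $\Phi$ (or $\phi_i$ for all $i$ if $\Phi(Y)=\sum_{i=1}^r\phi_i(\bm{y}_i)$) are proper closed and bounded from below; (ii) $\mathcal{A}\mathcal{A}^*=\mathcal{I}_q$; (iii) $\frac1\alpha+\frac1\beta=1$; (iv) when $\lambda=0$, $\mathcal{F}_0$ is level-bounded. **Update schemes.** Let $\mathcal{H}_\alpha(X,Y,Z):=\frac{\alpha}{2}\|XY^\top-Z\|_F^2$. Given $X^k,Y^k,Z^k$ and $\mu_k,\sigma_k>0$, $U$ is computed by one of: (U1) $U\in\arg\min_X\Psi(X)+\mathcal{H}_\alpha(X,Y^k,Z^k)+\frac\lambda2\|X-Y^k\|_F^2+\frac{\mu_k}{2}\|X-X^k\|_F^2$; (U2) $U\in\arg\min_X\Psi(X)+\langle\nabla_X\mathcal{H}_\alpha(X^k,Y^k,Z^k),X-X^k\rangle+\frac\lambda2\|X-Y^k\|_F^2+\frac{\mu_k}{2}\|X-X^k\|_F^2$; (U3) (if $\Psi(X)=\sum_i\psi_i(\bm{x}_i)$) successively for $i=1,\dots,r$: $\bm{u}_i\in\arg\min_{\bm{x}_i}\psi_i(\bm{x}_i)+\frac\alpha2\|\sum_{j<i}\bm{u}_j(\bm{y}_j^k)^\top+\bm{x}_i(\bm{y}_i^k)^\top+\sum_{j>i}\bm{x}_j^k(\bm{y}_j^k)^\top-Z^k\|_F^2+\frac\lambda2\|\bm{x}_i-\bm{y}_i^k\|^2+\frac{\mu_k}{2}\|\bm{x}_i-\bm{x}_i^k\|^2$.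 Then $V$ is computed by one of: (V1) $V\in\arg\min_Y\Phi(Y)+\mathcal{H}_\alpha(U,Y,Z^k)+\frac\lambda2\|U-Y\|_F^2+\frac{\sigma_k}{2}\|Y-Y^k\|_F^2$; (V2) $V\in\arg\min_Y\Phi(Y)+\langle\nabla_Y\mathcal{H}_\alpha(U,Y^k,Z^k),Y-Y^k\rangle+\frac\lambda2\|U-Y\|_F^2+\frac{\sigma_k}{2}\|Y-Y^k\|_F^2$; (V3) (if $\Phi(Y)=\sum_i\phi_i(\bm{y}_i)$) successively for $i=1,\dots,r$: $\bm{v}_i\in\arg\min_{\bm{y}_i}\phi_i(\bm{y}_i)+\frac\alpha2\|\sum_{j<i}\bm{u}_j\bm{v}_j^\top+\bm{u}_i\bm{y}_i^\top+\sum_{j>i}\bm{u}_j(\bm{y}_j^k)^\top-Z^k\|_F^2+\frac\lambda2\|\bm{u}_i-\bm{y}_i\|^2+\frac{\sigma_k}{2}\|\bm{y}_i-\bm{y}_i^k\|^2$. **Algorithm (A-NAUM).** Input: $(X^0,Y^0)\in\mathrm{dom}\,\mathcal{F}_\lambda$; $\alpha,\beta$ with $\frac1\alpha+\frac1\beta=1$; $\mu^{\min}>0$, $0<\sigma^{\min}<\sigma^{\max}<\infty$, $\tau>1$, $c>0$, $0<p_{\min}<1$; $\rho:=\|\mathcal{I}-\frac{\beta}{\alpha+\beta}\mathcal{A}^*\mathcal{A}\|^2$; $\gamma\ge0$ with $(\alpha+\gamma)\mathcal{I}+\beta\mathcal{A}^*\mathcal{A}\succeq0$. Set $\mathcal{R}_0=\mathcal{F}_\lambda(X^0,Y^0)$.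 For $k=0,1,2,\dots$ (run indefinitely): Step 1. $Z^k=(\mathcal{I}-\frac{\beta}{\alpha+\beta}\mathcal{A}^*\mathcal{A})(X^k(Y^k)^\top)+\frac{\beta}{\alpha+\beta}\mathcal{A}^*(\bm{b})$. Step 2. Choose $\mu_k^0\ge\mu^{\min}$, $\sigma_k^0\in[\sigma^{\min},\sigma^{\max}]$ arbitrarily; set $\mu_k=\mu_k^0$, $\sigma_k=\sigma_k^0$, $\mu_k^{\max}=(\alpha+2\gamma\rho)\|Y^k\|^2+c$. (2a) Set $\mu_k\leftarrow\min\{\mu_k,\mu_k^{\max}\}$; compute $U$ by either (U1), (U2) or (U3). (2b) Compute $V$ by either (V1), (V2) or (V3). (2c) If $\mathcal{F}_\lambda(U,V)-\mathcal{R}_k\le-\frac c2(\|U-X^k\|_F^2+\|V-Y^k\|_F^2)$, go to Step 3. (2d) If $\mu_k=\mu_k^{\max}$, set $\sigma_k^{\max}=(\alpha+2\gamma\rho)\|U\|^2+c$, $\sigma_k\leftarrow\min\{\tau\sigma_k,\sigma_k^{\max}\}$ and go to (2b); otherwise set $\mu_k\leftarrow\tau\mu_k$, $\sigma_k\leftarrow\tau\sigma_k$ and go to (2a). Step 3. Set $X^{k+1}=U$, $Y^{k+1}=V$, $\bar\mu_k=\mu_k$, $\bar\sigma_k=\sigma_k$; choose $p_{k+1}\in[p_{\min},1]$ and set $\mathcal{R}_{k+1}=(1-p_{k+1})\mathcal{R}_k+p_{k+1}\mathcal{F}_\lambda(X^{k+1},Y^{k+1})$. **Subdifferential, KL.**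 $\partial h$ is the limiting subdifferential: $\partial h(X)=\{D:\exists X^k\to X,\ h(X^k)\to h(X),\ D^k\to D,\ D^k\in\widehat\partial h(X^k)\}$, with $\widehat\partial h$ the Fréchet subdifferential. For $\nu>0$ let $\Phi_\nu$ be the class of concave $\varphi:[0,\nu)\to\mathbb{R}_+$ with $\varphi(0)=0$, $\varphi$ continuous at $0$ and continuously differentiable on $(0,\nu)$, $\varphi'>0$ on $(0,\nu)$. A proper closed $h$ has the KL property at $\widetilde X\in\mathrm{dom}\,\partial h:=\{X:\partial h(X)\neq\emptyset\}$ if there are $\nu\in(0,+\infty]$, a neighborhood $\mathcal{V}$ of $\widetilde X$ and $\varphi\in\Phi_\nu$ such that $\varphi'(h(X)-h(\widetilde X))\,\mathrm{dist}(0,\partial h(X))\ge1$ for all $X\in\mathcal{V}$ with $h(\widetilde X)<h(X)<h(\widetilde X)+\nu$. $h$ is a KL function if it has the KL property at every point of $\mathrm{dom}\,\partial h$; it is a KL function with exponent $\theta\in[0,1)$ if moreover $\varphi$ can be chosen as $\varphi(t)=\tilde a t^{1-\theta}$ for some $\tilde a>0$. *)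

(* Defs.v *)
From HB Require Import structures.
From mathcomp Require Import all_boot all_order all_algebra.
From mathcomp Require Import all_classical all_reals all_analysis.

Set Implicit Arguments.
Unset Strict Implicit.
Unset Printing Implicit Defensive.

Import Order.TTheory GRing.Theory Num.Theory.
Import numFieldNormedType.Exports.

Local Open Scope classical_set_scope.
Local Open Scope ring_scope.

(* Topological notions (convergence, neighbourhoods, boundedness, lower
   semicontinuity) come from the library's topology on matrices, induced by the
   max norm [`| _ |].  All quantitative statements use [fnorm] below. *)
Section Euclidean.
Variable R : realType.

Definition mdot m n (A B : 'M[R]_(m, n)) : R := \sum_i \sum_j A i j * B i j.

(* Frobenius norm; on column vectors it is the Euclidean norm. *)
Definition fnorm m n (A : 'M[R]_(m, n)) : R := Num.sqrt (mdot A A).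

(* Operator norm with respect to the Frobenius norms on both sides. *)
Definition opnorm m n m' n' (T : 'M[R]_(m, n) -> 'M[R]_(m', n')) : R :=
  sup [set fnorm (T M) | M in [set M | fnorm M <= 1]].

Definition specnorm m n (A : 'M[R]_(m, n)) : R :=
  opnorm (fun x : 'cV[R]_n => A *m x).

(* Gradient with respect to [mdot]: the matrix of partial derivatives. *)
Definition grad m n (f : 'M[R]_(m, n) -> R) (X : 'M[R]_(m, n)) : 'M[R]_(m, n) :=
  \matrix_(i, j) 'D_(delta_mx i j) f X.

Definition is_adjoint m n q
    (A : 'M[R]_(m, n) -> 'cV[R]_q) (As : 'cV[R]_q -> 'M[R]_(m, n)) : Prop :=
  forall M v, mdot (A M) v = mdot M (As v).

Definition psd_op m n (T : 'M[R]_(m, n) -> 'M[R]_(m, n)) : Prop :=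
  forall M, 0 <= mdot M (T M).

Definition is_argmin (T : Type) (f : T -> \bar R) (x : T) : Prop :=
  forall y, (f x <= f y)%E.

(* Functions with values in R U {+oo} are [\bar R]-valued functions that never
   take the value -oo. *)
Definition proper (T : Type) (f : T -> \bar R) : Prop :=
  (forall x, f x != -oo%E) /\ exists x, (f x < +oo)%E.

Definition bounded_below (T : Type) (f : T -> \bar R) : Prop :=
  exists m : R, forall x, (m%:E <= f x)%E.

Definition level_bounded (V : normedModType R) (f : V -> \bar R) : Prop :=
  forall a : R, bounded_set [set x | (f x <= a%:E)%E].

Definition proper_closed_bb (T : topologicalType) (f : T -> \bar R) : Prop :=
  [/\ proper f, lower_semicontinuous f & bounded_below f].

Definition column_separable n r (psi : 'I_r -> 'cV[R]_n -> \bar R)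
    (Psi : 'M[R]_(n, r) -> \bar R) : Prop :=
  (forall i x, psi i x != -oo%E) /\
  forall X, Psi X = (\sum_(i < r) psi i (col i X))%E.

Definition regular_penalty n r (Psi : 'M[R]_(n, r) -> \bar R) : Prop :=
  proper_closed_bb Psi \/
  exists2 psi : 'I_r -> 'cV[R]_n -> \bar R,
    column_separable psi Psi & forall i, proper_closed_bb (psi i).

End Euclidean.

Section KL.
Variables (R : realType) (n r : nat).

Local Notation E := ('M[R]_(n, r) * 'M[R]_(n, r))%type.

Definition pdot (V W : E) : R := mdot V.1 W.1 + mdot V.2 W.2.

Definition pnorm (V : E) : R := Num.sqrt (pdot V V).

Definition frechet_subdiff (h : E -> \bar R) (x : E) : set E :=
  [set D | h x \is a fin_num /\
    forall eps : R, 0 < eps -> \forall y \near x,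
      (h x + (pdot D (y - x) - eps * pnorm (y - x))%:E <= h y)%E].

Definition limiting_subdiff (h : E -> \bar R) (x : E) : set E :=
  [set D | h x \is a fin_num /\
    exists (xs Ds : nat -> E),
    [/\ xs @ \oo --> x, (h \o xs) @ \oo --> h x, Ds @ \oo --> D
      & forall j, frechet_subdiff h (xs j) (Ds j)]].

(* dist(0, S), equal to +oo when S is empty. *)
Definition dist0 (S : set E) : \bar R := ereal_inf [set (pnorm D)%:E | D in S].

(* [phi] is only constrained on [0, nu), where 0 < nu <= +oo. *)
Definition desingularizing (nu : \bar R) (phi : R -> R) : Prop :=
  let I0 := [set t : R^o | 0 <= t /\ (t%:E < nu)%E] in
  let I := [set t : R | 0 < t /\ (t%:E < nu)%E] in
  [/\ convex_function I0 (fun t => - phi t),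
      (forall t, I0 t -> 0 <= phi t) /\ phi 0 = 0,
      phi t @[t --> 0^'+] --> phi 0,
      (forall t, I t -> derivable phi t 1 /\ {for t, continuous (derive1 phi)})
    & forall t, I t -> 0 < derive1 phi t].

Definition KL_inequality (h : E -> \bar R) (x : E) (nu : \bar R) (V : set E)
    (phi : R -> R) : Prop :=
  forall y, V y -> (h x < h y)%E -> (h y < h x + nu)%E ->
    (1 <= (derive1 phi (fine (h y - h x)%E))%:E * dist0 (limiting_subdiff h y))%E.

Definition KL_exponent_at (h : E -> \bar R) (theta : R) (x : E) : Prop :=
  exists (nu : \bar R) (V : set E) (phi : R -> R),
  [/\ (0 < nu)%E, nbhs x V, desingularizing nu phi,
      exists2 a : R, 0 < a &
        forall t, 0 <= t -> (t%:E < nu)%E -> phi t = a * t `^ (1 - theta)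
    & KL_inequality h x nu V phi].

Definition KL_function_exponent (h : E -> \bar R) (theta : R) : Prop :=
  [/\ proper h, lower_semicontinuous h
    & forall x, limiting_subdiff h x !=set0 -> KL_exponent_at h theta x].

End KL.

Section ANAUM.
Variables (R : realType) (n r q : nat).
Variables (Psi Phi : 'M[R]_(n, r) -> \bar R).
Variables (A : {linear 'M[R]_n -> 'cV[R]_q}) (As : {linear 'cV[R]_q -> 'M[R]_n}).
Variables (b : 'cV[R]_q) (lambda : R).

Implicit Types (X Y U V : 'M[R]_(n, r)) (Z : 'M[R]_n).

Definition Fobj (W : 'M[R]_(n, r) * 'M[R]_(n, r)) : \bar R :=
  (Psi W.1 + Phi W.2
   + (2^-1 * fnorm (A (W.1 *m W.2^T) - b) ^+ 2
      + lambda / 2 * fnorm (W.1 - W.2) ^+ 2)%:E)%E.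

Variables (alpha beta : R).

Definition Hobj X Y Z : R := alpha / 2 * fnorm (X *m Y^T - Z) ^+ 2.

Section Updates.
Variables (Xk Yk : 'M[R]_(n, r)) (Zk : 'M[R]_n).

Definition U_prox (mu : R) U : Prop :=
  is_argmin (fun X => (Psi X + (Hobj X Yk Zk + lambda / 2 * fnorm (X - Yk) ^+ 2
                                + mu / 2 * fnorm (X - Xk) ^+ 2)%:E)%E) U.

Definition U_proxlin (mu : R) U : Prop :=
  is_argmin (fun X => (Psi X + (mdot (grad (fun X' => Hobj X' Yk Zk) Xk) (X - Xk)
                                + lambda / 2 * fnorm (X - Yk) ^+ 2
                                + mu / 2 * fnorm (X - Xk) ^+ 2)%:E)%E) U.

Definition U_columns (mu : R) U : Prop :=
  exists2 psi, column_separable psi Psi & forall i : 'I_r,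
  is_argmin (fun x : 'cV[R]_n =>
    (psi i x
     + (alpha / 2 * fnorm (\sum_(j < r | (j < i)%N) col j U *m (col j Yk)^T
                           + x *m (col i Yk)^T
                           + \sum_(j < r | (i < j)%N) col j Xk *m (col j Yk)^T
                           - Zk) ^+ 2
        + lambda / 2 * fnorm (x - col i Yk) ^+ 2
        + mu / 2 * fnorm (x - col i Xk) ^+ 2)%:E)%E) (col i U).

Definition U_update (mu : R) U : Prop :=
  [\/ U_prox mu U, U_proxlin mu U | U_columns mu U].

Definition V_prox U (sigma : R) V : Prop :=
  is_argmin (fun Y => (Phi Y + (Hobj U Y Zk + lambda / 2 * fnorm (U - Y) ^+ 2
                                + sigma / 2 * fnorm (Y - Yk) ^+ 2)%:E)%E) V.

Definition V_proxlin U (sigma : R) V : Prop :=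
  is_argmin (fun Y => (Phi Y + (mdot (grad (fun Y' => Hobj U Y' Zk) Yk) (Y - Yk)
                                + lambda / 2 * fnorm (U - Y) ^+ 2
                                + sigma / 2 * fnorm (Y - Yk) ^+ 2)%:E)%E) V.

Definition V_columns U (sigma : R) V : Prop :=
  exists2 phi, column_separable phi Phi & forall i : 'I_r,
  is_argmin (fun y : 'cV[R]_n =>
    (phi i y
     + (alpha / 2 * fnorm (\sum_(j < r | (j < i)%N) col j U *m (col j V)^T
                           + col i U *m y^T
                           + \sum_(j < r | (i < j)%N) col j U *m (col j Yk)^T
                           - Zk) ^+ 2
        + lambda / 2 * fnorm (col i U - y) ^+ 2
        + sigma / 2 * fnorm (y - col i Yk) ^+ 2)%:E)%E) (col i V).

Definition V_update U (sigma : R) V : Prop :=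
  [\/ V_prox U sigma V, V_proxlin U sigma V | V_columns U sigma V].

End Updates.

Definition Tmap (M : 'M[R]_n) : 'M[R]_n :=
  M - (beta / (alpha + beta)) *: As (A M).

Definition rho : R := opnorm Tmap ^+ 2.

Definition Zupd X Y : 'M[R]_n :=
  Tmap (X *m Y^T) + (beta / (alpha + beta)) *: As b.

Variables (mumin sigmin sigmax tau c pmin gamma : R).

(* mu_k^max as a function of Y^k, and sigma_k^max as a function of U. *)
Definition prox_cap Y : R := (alpha + 2 * gamma * rho) * specnorm Y ^+ 2 + c.

Definition ls_accept (Rk : R) Xk Yk U V : Prop :=
  (Fobj (U, V) - Rk%:E
   <= (- (c / 2 * (fnorm (U - Xk) ^+ 2 + fnorm (V - Yk) ^+ 2)))%:E)%E.

(* Reachable states of the line search of one outer iteration: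
   [ls_U mu sigma]: step (2a) is entered with the values (mu, sigma);
   [ls_V mu sigma U]: step (2b) is entered with the values (mu, sigma, U). *)
Section LineSearch.
Variables (Rk : R) (Xk Yk : 'M[R]_(n, r)) (mu0 sigma0 : R).
Let Zk := Zupd Xk Yk.

Inductive ls_U : R -> R -> Prop :=
| ls_init : ls_U mu0 sigma0
| ls_increase mu sigma U V :
    ls_V mu sigma U -> V_update Yk Zk U sigma V ->
    ~ ls_accept Rk Xk Yk U V -> mu <> prox_cap Yk ->
    ls_U (tau * mu) (tau * sigma)
with ls_V : R -> R -> 'M[R]_(n, r) -> Prop :=
| ls_compute_U mu sigma U :
    ls_U mu sigma -> U_update Xk Yk Zk (Num.min mu (prox_cap Yk)) U ->
    ls_V (Num.min mu (prox_cap Yk)) sigma U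
| ls_increase_sigma mu sigma U V :
    ls_V mu sigma U -> V_update Yk Zk U sigma V ->
    ~ ls_accept Rk Xk Yk U V -> mu = prox_cap Yk ->
    ls_V mu (Num.min (tau * sigma) (prox_cap U)) U.

Definition ls_result (mu sigma : R) U V : Prop :=
  [/\ ls_V mu sigma U, V_update Yk Zk U sigma V & ls_accept Rk Xk Yk U V].

End LineSearch.

Definition ANAUM_step (Rk : R) Xk Yk X' Y' : Prop :=
  exists mu0 sigma0 mu sigma : R,
  [/\ mumin <= mu0, sigmin <= sigma0 <= sigmax
    & ls_result Rk Xk Yk mu0 sigma0 mu sigma X' Y'].

Definition ANAUM_sequence (X Y : nat -> 'M[R]_(n, r)) : Prop :=
  exists Rs p : nat -> R,
  (Rs 0%N)%:E = Fobj (X 0%N, Y 0%N) /\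
  forall k,
  [/\ ANAUM_step (Rs k) (X k) (Y k) (X k.+1) (Y k.+1),
      pmin <= p k.+1 <= 1
    & (Rs k.+1)%:E = (((1 - p k.+1) * Rs k)%:E
                      + (p k.+1)%:E * Fobj (X k.+1, Y k.+1))%E].

End ANAUM.

(* Main.v *)
Require Import Defs.
From HB Require Import structures.
From mathcomp Require Import all_boot all_order all_algebra.
From mathcomp Require Import all_classical all_reals all_analysis.
From mathcomp Require Import ring lra.

Set Implicit Arguments.
Unset Strict Implicit.
Unset Printing Implicit Defensive.

Import Order.TTheory GRing.Theory Num.Theory.
Import numFieldNormedType.Exports.

Local Open Scope classical_set_scope.
Local Open Scope ring_scope.

(* The iterates satisfy a sufficient decrease with respect to the averaged
   reference value [Rk], and each new iterate carries a proximal, hence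
   limiting, subgradient of the objective whose norm is at most a constant times
   the step length: [Z^k] is chosen so that the partial gradients of
   [alpha / 2 * |X Y^T - Z^k|^2] at the current iterate are those of
   [1 / 2 * |A (X Y^T) - b|^2], because [alpha * beta = alpha + beta], and the
   line search keeps [mu_k] and [sigma_k] bounded.  Testing the proximal
   inequality at the limit point gives [F (X^k, Y^k) -> F (Xlim, Ylim)].
   Let [r_k = R_k - F (Xlim, Ylim)].  With
   [theta' = max theta (1 / 2)], the KL inequality gives
   [r_k ^ (2 theta') <= C (r_k - r_{k+1})]; whenever the objective is below its
   limit value, where KL says nothing, the averaging step alone contracts [r_k].
   By concavity of [t ^ (1 - theta')] the step lengths telescope to
   [r_k ^ (1 - theta')], so the distance to the limit is controlled by the decay
   of [r_k], which is geometric for [theta' = 1 / 2]; for [theta' > 1 / 2] the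
   quantity [r_k ^ (1 - 2 theta')] grows at least linearly. *)

(** * Frobenius inner product *)

Section FrobeniusInnerProduct.
Variable R : realType.

Lemma mdot_tr m n (A B : 'M[R]_(m, n)) : mdot A B = \tr (A *m B^T).
Proof.
apply: eq_bigr => i _; rewrite mxE; apply: eq_bigr => j _.
by rewrite mxE.
Qed.

Lemma mdotC m n (A B : 'M[R]_(m, n)) : mdot A B = mdot B A.
Proof. by apply: eq_bigr => i _; apply: eq_bigr => j _; rewrite mulrC. Qed.

Lemma mdotDl m n (A B C : 'M[R]_(m, n)) : mdot (A + B) C = mdot A C + mdot B C.
Proof. by rewrite !mdot_tr mulmxDl mxtraceD. Qed.

Lemma mdotZl m n a (A C : 'M[R]_(m, n)) : mdot (a *: A) C = a * mdot A C.
Proof. by rewrite !mdot_tr -scalemxAl mxtraceZ. Qed.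

Lemma mdotDr m n (A B C : 'M[R]_(m, n)) : mdot C (A + B) = mdot C A + mdot C B.
Proof. by rewrite mdotC mdotDl !(mdotC C). Qed.

Lemma mdotZr m n a (A C : 'M[R]_(m, n)) : mdot C (a *: A) = a * mdot C A.
Proof. by rewrite mdotC mdotZl (mdotC C). Qed.

Lemma mdotNl m n (A C : 'M[R]_(m, n)) : mdot (- A) C = - mdot A C.
Proof. by rewrite -scaleN1r mdotZl mulN1r. Qed.

Lemma mdotNr m n (A C : 'M[R]_(m, n)) : mdot C (- A) = - mdot C A.
Proof. by rewrite mdotC mdotNl mdotC. Qed.

Lemma mdot0l m n (C : 'M[R]_(m, n)) : mdot 0 C = 0.
Proof. by rewrite -(scale0r 0) mdotZl mul0r. Qed.

Definition mdotE := (mdotDl, mdotDr, mdotNl, mdotNr, mdotZl, mdotZr).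

Lemma mdot_ge0 m n (A : 'M[R]_(m, n)) : 0 <= mdot A A.
Proof. by do 2!apply: sumr_ge0 => ? _; rewrite -expr2 sqr_ge0. Qed.

Lemma mdot_trmx m n (A B : 'M[R]_(m, n)) : mdot A^T B^T = mdot A B.
Proof. by rewrite !mdot_tr trmxK mxtrace_mulC -mxtrace_tr trmx_mul trmxK. Qed.

Lemma mdot_mulmxl m n p (A : 'M[R]_(m, n)) (B : 'M[R]_(n, p)) C :
  mdot (A *m B) C = mdot A (C *m B^T).
Proof. by rewrite !mdot_tr trmx_mul trmxK mulmxA. Qed.

Lemma mdot_mulmxr m n p (A : 'M[R]_(m, n)) (B : 'M[R]_(n, p)) C :
  mdot (A *m B) C = mdot B (A^T *m C).
Proof. by rewrite -mdot_trmx trmx_mul mdot_mulmxl -mdot_trmx trmx_mul !trmxK. Qed.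

Lemma mdot_cols m n (A B : 'M[R]_(m, n)) :
  mdot A B = \sum_j mdot (col j A) (col j B).
Proof.
rewrite /mdot exchange_big; apply: eq_bigr => j _; apply: eq_bigr => i _.
by rewrite big_ord1 !mxE.
Qed.

Lemma mdot_rows m n (A B : 'M[R]_(m, n)) :
  mdot A B = \sum_i mdot (row i A) (row i B).
Proof.
apply: eq_bigr => i _; rewrite /mdot big_ord1.
by apply: eq_bigr => j _; rewrite !mxE.
Qed.

Lemma fnorm_ge0 m n (A : 'M[R]_(m, n)) : 0 <= fnorm A.
Proof. exact: sqrtr_ge0. Qed.
Hint Resolve fnorm_ge0 : core.

Lemma sqr_fnorm m n (A : 'M[R]_(m, n)) : fnorm A ^+ 2 = mdot A A.
Proof. by rewrite sqr_sqrtr ?mdot_ge0. Qed.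

(** Discriminant argument: the quadratic [t |-> |A + t B|^2] is nonnegative at its minimizer. If
    [mdot B B = 0] it is affine in [t], and a nonzero slope would let it reach -1. *)
Lemma cauchy_schwarz_sqr m n (A B : 'M[R]_(m, n)) :
  mdot A B ^+ 2 <= mdot A A * mdot B B.
Proof.
have A0 := mdot_ge0 A; have B0 := mdot_ge0 B.
have H t : 0 <= mdot A A + 2 * t * mdot A B + t ^+ 2 * mdot B B.
  have := mdot_ge0 (A + t *: B); rewrite !mdotE (mdotC B A); lra.
have [B00|Bn0] := eqVneq (mdot B B) 0; last first.
  have := H (- (mdot A B / mdot B B)).
  set a := mdot A A; set c := mdot A B; set d := mdot B B => h.
  have d0 : 0 < d by rewrite lt_def Bn0.
  have -> : c ^+ 2 = a * d - (a + 2 * - (c / d) * c + (- (c / d)) ^+ 2 * d) * d.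
    by field; rewrite gt_eqF.
  by rewrite lerBlDr lerDl mulr_ge0 // ltW.
have [->|c0] := eqVneq (mdot A B) 0; first by rewrite expr0n /= mulr_ge0.
have := H (- ((mdot A A + 1) / (2 * mdot A B))).
rewrite B00 mulr0 addr0.
have -> : 2 * - ((mdot A A + 1) / (2 * mdot A B)) * mdot A B = - (mdot A A + 1).
  by field.
lra.
Qed.

Lemma normr_mdot m n (A B : 'M[R]_(m, n)) : `|mdot A B| <= fnorm A * fnorm B.
Proof.
rewrite -sqrtr_sqr /fnorm -sqrtrM ?mdot_ge0 //.
by rewrite ler_wsqrtr // cauchy_schwarz_sqr.
Qed.

Lemma mdot_le m n (A B : 'M[R]_(m, n)) : mdot A B <= fnorm A * fnorm B.
Proof. exact: le_trans (ler_norm _) (normr_mdot A B). Qed.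

Lemma fnormD m n (A B : 'M[R]_(m, n)) : fnorm (A + B) <= fnorm A + fnorm B.
Proof.
rewrite -(@ler_pXn2r _ 2) // ?nnegrE ?addr_ge0 //.
rewrite sqrrD !sqr_fnorm !mdotE (mdotC B A).
have := mdot_le A B; lra.
Qed.

Lemma fnormZ m n a (A : 'M[R]_(m, n)) : fnorm (a *: A) = `|a| * fnorm A.
Proof.
by rewrite /fnorm !mdotE mulrA -expr2 sqrtrM ?sqr_ge0 // sqrtr_sqr.
Qed.

Lemma fnormN m n (A : 'M[R]_(m, n)) : fnorm (- A) = fnorm A.
Proof. by rewrite -scaleN1r fnormZ normrN1 mul1r. Qed.

Lemma fnormB m n (A B : 'M[R]_(m, n)) : fnorm (A - B) <= fnorm A + fnorm B.
Proof. by rewrite -(fnormN B); exact: fnormD. Qed.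

Lemma fnormBC m n (A B : 'M[R]_(m, n)) : fnorm (A - B) = fnorm (B - A).
Proof. by rewrite -fnormN opprB. Qed.

Lemma fnorm0 m n : fnorm (0 : 'M[R]_(m, n)) = 0.
Proof. by rewrite -(scale0r 0) fnormZ normr0 mul0r. Qed.

Lemma fnorm_trmx m n (A : 'M[R]_(m, n)) : fnorm A^T = fnorm A.
Proof. by rewrite /fnorm mdot_trmx. Qed.

Lemma fnormM m n p (A : 'M[R]_(m, n)) (B : 'M[R]_(n, p)) :
  fnorm (A *m B) <= fnorm A * fnorm B.
Proof.
rewrite -(@ler_pXn2r _ 2) // ?nnegrE ?mulr_ge0 //.
rewrite exprMn !sqr_fnorm (mdot_rows A) (mdot_cols B) mulr_suml.
apply: ler_sum => i _; rewrite mulr_sumr; apply: ler_sum => j _.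
have -> : (A *m B) i j = mdot (row i A)^T (col j B).
  rewrite mxE /mdot; apply: eq_bigr => k _; rewrite big_ord1 !mxE //.
by rewrite -expr2 -(mdot_trmx (row i A)) cauchy_schwarz_sqr.
Qed.

Lemma fnorm_mulmx_le m n p a b (A : 'M[R]_(m, n)) (B : 'M[R]_(n, p)) :
  fnorm A <= a -> fnorm B <= b -> fnorm (A *m B) <= a * b.
Proof.
by move=> ha hb; apply: le_trans (fnormM A B) _; rewrite ler_pM.
Qed.

Lemma ler_entry_fnorm m n (A : 'M[R]_(m, n)) i j : `|A i j| <= fnorm A.
Proof.
rewrite -sqrtr_sqr ler_wsqrtr // /mdot (bigD1 i) //= (bigD1 j) //= -expr2 -addrA.
rewrite lerDl addr_ge0 //; first by apply: sumr_ge0 => ? _; rewrite -expr2 sqr_ge0.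
by do 2!apply: sumr_ge0 => ? _; rewrite -expr2 sqr_ge0.
Qed.

Lemma mx_norm_le_fnorm m n (A : 'M[R]_(m, n)) : `|A| <= fnorm A.
Proof.
rewrite {1}/Num.norm /= mx_normrE; apply/bigmax_leP; split => // -[i j] _.
exact: ler_entry_fnorm.
Qed.

(** The added 1 keeps the constant positive for empty matrices, so that radii can be divided by
    it. *)
Lemma fnorm_le_mx_norm m n (A : 'M[R]_(m, n)) :
  fnorm A <= ((m * n)%:R + 1) * `|A|.
Proof.
rewrite -(@ler_pXn2r _ 2) // ?nnegrE ?mulr_ge0 ?addr_ge0 // sqr_fnorm.
have H i j : A i j * A i j <= `|A| ^+ 2.
  rewrite -expr2 -real_normK ?num_real // ler_pXn2r ?nnegrE //.
  rewrite [leRHS]/Num.norm /= mx_normrE.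
  exact: (le_bigmax _ (fun ij : 'I_m * 'I_n => `|A ij.1 ij.2|) (i, j)).
apply: (@le_trans _ _ ((m * n)%:R * `|A| ^+ 2)).
  rewrite /mdot pair_big /=.
  apply: le_trans (ler_sum _ (fun ij _ => H ij.1 ij.2)) _.
  rewrite sumr_const card_prod !card_ord mulr_natl //.
rewrite exprMn ler_wpM2r ?sqr_ge0 // expr2.
set k : R := (m * n)%:R; have k0 : 0 <= k by []; nra.
Qed.

End FrobeniusInnerProduct.
#[local] Hint Extern 0 (is_true (0 <= fnorm _)) => apply: fnorm_ge0 : core.

(** * Proximal subgradients of the block updates *)

Section ProximalSubgradient.
Variable R : realType.

(** Along the line the difference quotient is [B + h * C] for [h != 0], so its limit is read off
    without differentiability lemmas for matrix products. *)
Lemma derive_quadratic m n (f : 'M[R]_(m, n) -> R) X V B C :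
  (forall h, f (h *: V + X) = f X + h * B + h ^+ 2 * C) -> 'D_V f X = B.
Proof.
move=> fE; apply: cvg_lim => //.
have : (fun h : R => B + h * C) @ 0^' --> B + 0 * C.
  apply: cvg_within_filter.
  by apply: cvgD; [exact: cvg_cst|apply: cvgM; [exact: cvg_id|exact: cvg_cst]].
rewrite mul0r addr0.
apply: cvg_trans; apply: near_eq_cvg; near=> h.
have h0 : h != 0 by near: h; exact: nbhs_dnbhs_neq.
rewrite /= fE -[RHS]/(h^-1 * (f X + h * B + h ^+ 2 * C - f X)); field.
exact: h0.
Unshelve. all: by end_near. Qed.

Lemma grad_Hobj n r alpha (X Y : 'M[R]_(n, r)) Z :
  grad (fun X' => Hobj alpha X' Y Z) X = alpha *: ((X *m Y^T - Z) *m Y).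
Proof.
apply/matrixP => i j; rewrite [LHS]mxE [RHS]mxE.
set D : 'M[R]_(n, r) := delta_mx i j.
apply: (@derive_quadratic _ _ _ _ _ _ (alpha / 2 * mdot (D *m Y^T) (D *m Y^T))).
move=> h; rewrite /Hobj !sqr_fnorm; set N := X *m Y^T - Z.
have -> : (h *: D + X) *m Y^T - Z = h *: (D *m Y^T) + N.
  by rewrite mulmxDl -scalemxAl addrA.
have -> : ((N *m Y) i j) = mdot D (N *m Y).
  rewrite /mdot (bigD1 i) //= (bigD1 j) //= big1 ?addr0; last first.
    by move=> k /negPf kj; rewrite mxE kj andbF mul0r.
  rewrite big1 ?addr0 ?mxE ?eqxx ?mul1r // => k /negPf ki.
  by rewrite big1 // => l _; rewrite mxE ki mul0r.
have -> : mdot D (N *m Y) = mdot (D *m Y^T) N by rewrite mdot_mulmxl trmxK.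
clearbody N; by rewrite !mdotE (mdotC N); field.
Qed.

(** The quadratic minorant is global, not only local at [U], so that it can later be tested at the
    limit of the iterates. *)
Definition prox_subgrad m n (C : R) (Psi : 'M[R]_(m, n) -> \bar R) U G :=
  forall X, (Psi U + (mdot G (X - U) - C * fnorm (X - U) ^+ 2)%:E <= Psi X)%E.

(** Minimality compares the model at [U] and at [X]. Expanding it around [U], the first-order terms
    give the subgradient and the second-order ones are at most [C * |X - U|^2]. Taking [g = 0]
    covers the exact proximal and the column steps, [a = 0] the linearized one. *)
Lemma prox_subgrad_quadratic m n p a l mu (Psi : 'M[R]_(m, n) -> \bar R) C
    (g X0 Y U : 'M[R]_(m, n)) (W : 'M[R]_(p, n)) N :
  is_argmin (fun X => (Psi X + (mdot g (X - X0)
    + a / 2 * fnorm (X *m W^T + N) ^+ 2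
    + l / 2 * fnorm (X - Y) ^+ 2 + mu / 2 * fnorm (X - X0) ^+ 2)%:E)%E) U ->
  (`|a| * fnorm W ^+ 2 + `|l| + `|mu|) / 2 <= C ->
  prox_subgrad C Psi U
    (- (g + a *: ((U *m W^T + N) *m W) + l *: (U - Y) + mu *: (U - X0))).
Proof.
move=> Umin hC X; have := Umin X; set qU : R := (X in (_ + X%:E <= _)%E).
set qX : R := (X in (_ <= _ + X%:E)%E -> _) => h.
have hq : (Psi U + (qU - qX)%:E <= Psi X)%E.
  by rewrite EFinB addeA leeBlDr.
apply: le_trans hq; apply: leeD2l; rewrite lee_fin.
rewrite /qU /qX; set H := X - U; have -> : X = U + H by rewrite addrC subrK.
set N' := U *m W^T + N; set UY := U - Y; set UX := U - X0.
have -> : U + H - Y = UY + H by rewrite addrAC.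
have -> : U + H - X0 = UX + H by rewrite addrAC.
have -> : (U + H) *m W^T + N = N' + H *m W^T by rewrite mulmxDl addrAC.
clearbody H N' UY UX.
rewrite !sqr_fnorm !mdotE (mdotC H UY) (mdotC H UX).
have -> : mdot (N' *m W) H = mdot (H *m W^T) N' by rewrite mdot_mulmxl mdotC.
rewrite (mdotC N' (H *m W^T)).
have H0 := mdot_ge0 H.
have HW : mdot (H *m W^T) (H *m W^T) <= mdot H H * fnorm W ^+ 2.
  rewrite -!sqr_fnorm -exprMn ler_pXn2r ?nnegrE ?mulr_ge0 //.
  by rewrite -(fnorm_trmx W) fnormM.
have HW0 := mdot_ge0 (H *m W^T).
have h1 : a * mdot (H *m W^T) (H *m W^T) <= `|a| * (mdot H H * fnorm W ^+ 2).
  have := ler_wpM2l (normr_ge0 a) HW; apply: le_trans.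
  by rewrite ler_wpM2r ?ler_norm.
have h2 : l * mdot H H <= `|l| * mdot H H by rewrite ler_wpM2r ?ler_norm.
have h3 : mu * mdot H H <= `|mu| * mdot H H by rewrite ler_wpM2r ?ler_norm.
have h4 := ler_wpM2r H0 hC.
lra.
Qed.

Lemma prox_subgrad_columns n r C psi (Psi : 'M[R]_(n, r) -> \bar R) U G :
  column_separable psi Psi ->
  (forall i, prox_subgrad C (psi i) (col i U) (col i G)) ->
  prox_subgrad C Psi U G.
Proof.
move=> [_ PsiE] H X; rewrite !PsiE sqr_fnorm !(mdot_cols _ (X - U)).
rewrite mulr_sumr -sumrB -sumEFin -big_split; apply: lee_sum => i _.
have -> : col i (X - U) = col i X - col i U by apply/matrixP=> ? ?; rewrite !mxE.
by rewrite -sqr_fnorm; exact: H.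
Qed.

Lemma fnorm_col_le n r (Y : 'M[R]_(n, r)) i : fnorm (col i Y) <= fnorm Y.
Proof.
rewrite ler_wsqrtr // (mdot_cols Y) (bigD1 i) //= lerDl.
by apply: sumr_ge0 => j _; exact: mdot_ge0.
Qed.

(* The column-wise sweep differs from the linearized step by
   [(U - Xk) *m T] with [T] the upper triangular part of [Yk^T *m Yk]. *)
Lemma U_update_prox_subgrad n r (Psi : 'M[R]_(n, r) -> \bar R) lambda alpha
    Xk Yk Zk mu U :
  U_update Psi lambda alpha Xk Yk Zk mu U ->
  exists2 T, fnorm T <= fnorm Yk ^+ 2 &
    prox_subgrad ((`|alpha| * fnorm Yk ^+ 2 + `|lambda| + `|mu|) / 2) Psi U
      (- (alpha *: ((Xk *m Yk^T - Zk) *m Yk + (U - Xk) *m T)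
          + lambda *: (U - Yk) + mu *: (U - Xk))).
Proof.
case=> [Umin|Umin|[psi psiE Umin]].
- exists (Yk^T *m Yk).
    by rewrite expr2 -{1}(fnorm_trmx Yk) fnormM.
  have := @prox_subgrad_quadratic _ _ _ alpha lambda mu Psi _ 0 Xk Yk U Yk (- Zk)
    _ (lexx _).
  have -> : 0 + alpha *: ((U *m Yk^T - Zk) *m Yk)
    = alpha *: ((Xk *m Yk^T - Zk) *m Yk + (U - Xk) *m (Yk^T *m Yk)).
    rewrite add0r mulmxA -mulmxDl (mulmxBl U Xk); congr (_ *: (_ *m _)).
    by rewrite [RHS]addrC addrA subrK.
  apply; move=> X; have := Umin X; rewrite /Hobj.
  by rewrite !mdot0l !add0r.
- exists 0; first by rewrite fnorm0 sqr_ge0.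
  have := @prox_subgrad_quadratic _ _ _ 0 lambda mu Psi
    ((`|alpha| * fnorm Yk ^+ 2 + `|lambda| + `|mu|) / 2)
    (alpha *: ((Xk *m Yk^T - Zk) *m Yk)) Xk Yk U Yk (- Zk).
  rewrite mulmx0 addr0 scale0r addr0; apply.
    move=> X; have := Umin X; rewrite grad_Hobj.
    by rewrite !mul0r !addr0.
  rewrite normr0 mul0r add0r ler_pM2r // -addrA lerDr mulr_ge0 ?sqr_ge0 //.
pose T : 'M[R]_r := \matrix_(j, i) if (j <= i)%N then (Yk^T *m Yk) j i else 0.
exists T.
  have : fnorm (Yk^T *m Yk) <= fnorm Yk ^+ 2.
    by rewrite expr2 -{1}(fnorm_trmx Yk) fnormM.
  apply: le_trans; rewrite ler_wsqrtr //.
  apply: ler_sum => i _; apply: ler_sum => j _; rewrite !mxE.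
  by case: ifP => // _; rewrite mul0r -expr2 sqr_ge0.
apply: (prox_subgrad_columns psiE) => i.
set N := \sum_(j < r | (j < i)%N) col j U *m (col j Yk)^T
   + \sum_(j < r | (i < j)%N) col j Xk *m (col j Yk)^T - Zk.
have := @prox_subgrad_quadratic _ _ _ alpha lambda mu (psi i)
   ((`|alpha| * fnorm Yk ^+ 2 + `|lambda| + `|mu|) / 2) 0
   (col i Xk) (col i Yk) (col i U) (col i Yk) N.
have -> : - (0 + alpha *: ((col i U *m (col i Yk)^T + N) *m col i Yk) +
      lambda *: (col i U - col i Yk) + mu *: (col i U - col i Xk)) =
   col i (- (alpha *: ((Xk *m Yk^T - Zk) *m Yk + (U - Xk) *m T) +
         lambda *: (U - Yk) + mu *: (U - Xk))).
  have colM m p (A : 'M[R]_(m, p)) (B : 'M[R]_(p, r)) : A *m col i B = col i (A *m B).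
    by rewrite !colE mulmxA.
  have outer (P Q : 'M[R]_(n, r)) : P *m Q^T = \sum_j col j P *m (col j Q)^T.
    apply/matrixP => a b; rewrite summxE mxE; apply: eq_bigr => j _.
    by rewrite !mxE big_ord1 !mxE.
  (* At the optimum of column [i] the columns [j <= i] are new and the others old, so the residual
     is the old one plus the corrections of the columns [j <= i]. *)
  have -> : col i U *m (col i Yk)^T + N = (Xk *m Yk^T - Zk)
     + \sum_(j < r | (j <= i)%N) col j (U - Xk) *m (col j Yk)^T.
    rewrite /N outer.
    have -> : \sum_(j < r | (j <= i)%N) col j (U - Xk) *m (col j Yk)^T =
      \sum_(j < r | (j <= i)%N) col j U *m (col j Yk)^T -
      \sum_(j < r | (j <= i)%N) col j Xk *m (col j Yk)^T.
      rewrite -sumrB; apply: eq_bigr => j _; rewrite -mulmxBl.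
      by congr (_ *m _); apply/matrixP => ? ?; rewrite !mxE.
    rewrite [X in _ = X - Zk + _](bigID (fun j : 'I_r => (j <= i)%N)) /=.
    under [X in _ = _ + X - Zk + _]eq_bigl => j do rewrite -ltnNge.
    rewrite [X in _ = _ + (X - _)](bigD1 i) //=.
    under [X in _ = _ + (_ + X - _)]eq_bigl => j do rewrite andbC -ltn_neqAle.
    set S1 := \sum_(j < r | (j < i)%N) _; set S2 := \sum_(j < r | (i < j)%N) _.
    set S3 := \sum_(j < r | (j <= i)%N) _.
    apply/matrixP => a b; rewrite !mxE; ring.
  rewrite (mulmxDl (Xk *m Yk^T - Zk)) colM.
  have -> : (\sum_(j < r | (j <= i)%N) col j (U - Xk) *m (col j Yk)^T) *m col i Yk
     = col i ((U - Xk) *m T).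
    rewrite mulmx_suml; apply/matrixP => a b; rewrite summxE !mxE.
    rewrite [LHS]big_mkcond /=; apply: eq_bigr => j _; rewrite !(mxE matrix_key).
    case: ifP => ji; rewrite ?mulr0 //.
    rewrite -mulmxA mxE big_ord1; congr (_ * _); first by rewrite !mxE.
    by rewrite !mxE; apply: eq_bigr => k _; rewrite !mxE.
  set P := _ *m Yk; set Q := _ *m T; clearbody P Q.
  by apply/matrixP => a b; rewrite !mxE; ring.
apply.
  move=> x; have := Umin i x.
  rewrite !mdot0l !add0r.
  have reorder z : \sum_(j < r | (j < i)%N) col j U *m (col j Yk)^T + z
     + \sum_(j < r | (i < j)%N) col j Xk *m (col j Yk)^T - Zk = z + N.
    by rewrite /N !addrA [z + _]addrC.
  by rewrite !reorder.
rewrite ler_pM2r // !lerD2r ler_wpM2l // ler_pXn2r ?nnegrE //.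
exact: fnorm_col_le.
Qed.

Lemma V_update_U_update n r (Phi : 'M[R]_(n, r) -> \bar R) lambda alpha
    Yk Zk U sigma V :
  V_update Phi lambda alpha Yk Zk U sigma V ->
  U_update Phi lambda alpha Yk U Zk^T sigma V.
Proof.
have HT (P Q : 'M[R]_(n, r)) : Hobj alpha P Q Zk = Hobj alpha Q P Zk^T.
  by rewrite /Hobj -fnorm_trmx linearB /= trmx_mul trmxK.
case=> [Vmin|Vmin|[phi phiE Vmin]].
- apply: Or31 => Y; have := Vmin Y.
  by rewrite !HT (fnormBC U Y) (fnormBC U V).
- apply: Or32 => Y; have := Vmin Y.
  have -> : Hobj alpha U ^~ Zk = (fun X' => Hobj alpha X' U Zk^T).
    by apply/funext => Y'; rewrite HT.
  by rewrite (fnormBC U Y) (fnormBC U V).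
apply: Or33; exists phi => // i y; have := Vmin i y => /=.
rewrite (fnormBC (col i U) y) (fnormBC (col i U)).
have tr_outer (p : pred 'I_r) (P Q : 'M[R]_(n, r)) :
  (\sum_(j | p j) col j P *m (col j Q)^T)^T = \sum_(j | p j) col j Q *m (col j P)^T.
  by rewrite linear_sum; apply: eq_bigr => j _; rewrite /= trmx_mul trmxK.
have trE z : fnorm (\sum_(j < r | (j < i)%N) col j U *m (col j V)^T
      + col i U *m z^T + \sum_(j < r | (i < j)%N) col j U *m (col j Yk)^T - Zk)
    = fnorm (\sum_(j < r | (j < i)%N) col j V *m (col j U)^T
      + z *m (col i U)^T + \sum_(j < r | (i < j)%N) col j Yk *m (col j U)^T - Zk^T).
  rewrite -fnorm_trmx linearB /= [(_ + _ + _)^T]linearD /= [(_ + _)^T]linearD /=.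
  by rewrite !tr_outer trmx_mul trmxK.
by rewrite !trE.
Qed.

End ProximalSubgradient.

(** * Subgradients of the objective *)

Section ObjectiveSubgradient.
Variables (R : realType) (n r q : nat).
Variables (Psi Phi : 'M[R]_(n, r) -> \bar R).
Variables (A : {linear 'M[R]_n -> 'cV[R]_q}) (As : {linear 'cV[R]_q -> 'M[R]_n}).
Variables (b : 'cV[R]_q) (lambda alpha beta : R).
Hypothesis adjA : is_adjoint A As.
Hypothesis AAs : forall v, A (As v) = v.

Local Notation F := (Fobj Psi Phi A b lambda).

Lemma fnorm_As v : fnorm (As v) = fnorm v.
Proof. by rewrite /fnorm -adjA AAs. Qed.

(** [|A M|^2 = <M, As (A M)> <= |M| |A M|], because [As] is an isometry. *)
Lemma fnorm_A_le M : fnorm (A M) <= fnorm M.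
Proof.
have := mdot_le M (As (A M)); rewrite fnorm_As -adjA -sqr_fnorm expr2.
have [->|n0] := eqVneq (fnorm (A M)) 0; first by rewrite fnorm_ge0.
by rewrite ler_pM2r // lt_def n0 fnorm_ge0.
Qed.

(** The gradient of [M |-> 1 / 2 * |A M - b|^2] at [U V^T]. *)
Definition residual (U V : 'M[R]_(n, r)) : 'M[R]_n := As (A (U *m V^T) - b).

Lemma residualE U V : residual U V = As (A (U *m V^T)) - As b.
Proof. by rewrite /residual linearB. Qed.

Lemma scale_Zupd_residual X Y : alpha != 0 -> beta != 0 ->
  alpha^-1 + beta^-1 = 1 ->
  alpha *: (X *m Y^T - Zupd A As b alpha beta X Y) = residual X Y.
Proof.
move=> a0 b0 ab.
have abE : alpha + beta = alpha * beta.
  rewrite -[RHS]mulr1 -ab; field; by rewrite a0 b0.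
have -> : X *m Y^T - Zupd A As b alpha beta X Y
    = (beta / (alpha + beta)) *: residual X Y.
  rewrite /Zupd /Tmap residualE scalerBr opprD opprB.
  by rewrite addrA [_ + (_ - _)]addrC subrK.
rewrite scalerA abE; have -> : alpha * (beta / (alpha * beta)) = 1.
  by field; rewrite a0 b0.
by rewrite scale1r.
Qed.

Lemma smooth_part_expansion U V H K : 0 <= lambda ->
  2^-1 * fnorm (A (U *m V^T) - b) ^+ 2 + lambda / 2 * fnorm (U - V) ^+ 2
  + (mdot (residual U V *m V + lambda *: (U - V)) H
     + mdot ((residual U V)^T *m U + lambda *: (V - U)) K
     - fnorm (residual U V) * (fnorm H * fnorm K))
  <= 2^-1 * fnorm (A ((U + H) *m (V + K)^T) - b) ^+ 2
     + lambda / 2 * fnorm (U + H - (V + K)) ^+ 2.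
Proof.
move=> l0; set E := residual U V.
pose L := H *m V^T + U *m K^T; pose Q := H *m K^T.
have -> : A ((U + H) *m (V + K)^T) - b = (A (U *m V^T) - b) + A (L + Q).
  rewrite addrAC -linearD; congr (A _ - b).
  rewrite /L /Q linearD /= !(mulmxDl, mulmxDr) -!addrA; congr (_ + _).
  by rewrite addrCA.
have -> : U + H - (V + K) = (U - V) + (H - K) by rewrite opprD addrACA.
have -> : V - U = - (U - V) by rewrite opprB.
set D := U - V; set J := H - K; set e := A (U *m V^T) - b.
have EL : mdot E L = mdot (E *m V) H + mdot (E^T *m U) K.
  rewrite /L mdotDr; congr (_ + _); first by rewrite mdot_mulmxl.
  by rewrite mdotC mdot_mulmxr -mdot_trmx trmx_mul !trmxK mdotC.
have EQ : - (fnorm E * (fnorm H * fnorm K)) <= mdot E Q.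
  rewrite lerNl; apply: le_trans (ler_norm _) _; rewrite normrN.
  apply: le_trans (normr_mdot _ _) _; rewrite ler_wpM2l // -(fnorm_trmx K).
  exact: fnormM.
have DJ : mdot D H - mdot D K = mdot D J by rewrite /J !mdotE.
have eAE M : mdot e (A M) = mdot E M by rewrite mdotC adjA mdotC.
have := eAE (L + Q); rewrite mdotDr EL.
move: (A (L + Q)) => a eaE.
clearbody D J e.
rewrite !sqr_fnorm !mdotE (mdotC a e) eaE (mdotC J D) -DJ.
have := mdot_ge0 a.
have := mulr_ge0 l0 (mdot_ge0 J).
lra.
Qed.

Lemma sqr_pnorm (D : 'M[R]_(n, r) * 'M[R]_(n, r)) :
  pnorm D ^+ 2 = fnorm D.1 ^+ 2 + fnorm D.2 ^+ 2.
Proof. by rewrite sqr_sqrtr /pdot ?addr_ge0 ?mdot_ge0 // !sqr_fnorm. Qed.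

Lemma pnorm_le (D : 'M[R]_(n, r) * 'M[R]_(n, r)) :
  pnorm D <= fnorm D.1 + fnorm D.2.
Proof.
rewrite -(@ler_pXn2r _ 2) // ?nnegrE ?addr_ge0 ?sqrtr_ge0 //.
by rewrite sqr_pnorm sqrrD -addrA lerD2l lerDr mulrn_wge0 // mulr_ge0.
Qed.

Definition prox_subgrad2 (C : R) (h : 'M[R]_(n, r) * 'M[R]_(n, r) -> \bar R) W G :=
  forall W', (h W + (pdot G (W' - W) - C * pnorm (W' - W) ^+ 2)%:E <= h W')%E.

Lemma Fobj_prox_subgrad U V CU CV GU GV : 0 <= lambda ->
  prox_subgrad CU Psi U GU -> prox_subgrad CV Phi V GV ->
  0 <= CU -> 0 <= CV ->
  prox_subgrad2 (CU + CV + fnorm (residual U V)) F (U, V)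
   (GU + (residual U V *m V + lambda *: (U - V)),
    GV + ((residual U V)^T *m U + lambda *: (V - U))).
Proof.
move=> l0 hU hV CU0 CV0 [X Y]; rewrite /Fobj /=.
have := smooth_part_expansion U V (X - U) (Y - V) l0.
have -> : U + (X - U) = X by rewrite addrC subrK.
have -> : V + (Y - V) = Y by rewrite addrC subrK.
set s0 := 2^-1 * _ + _; set s1 := 2^-1 * _ ^+ 2 + _ => /= hs.
have := hU X; have := hV Y.
set H := X - U; set K := Y - V.
set gU := mdot GU H; set gV := mdot GV K => hV' hU'.
have step : (Psi U + Phi V + s0%:E + (gU - CU * fnorm H ^+ 2 + (gV - CV * fnorm K ^+ 2) +
   (s1 - s0))%:E <= Psi X + Phi Y + s1%:E)%E.
  have -> : (Psi U + Phi V + s0%:E +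
      (gU - CU * fnorm H ^+ 2 + (gV - CV * fnorm K ^+ 2) + (s1 - s0))%:E)%E
    = (Psi U + (gU - CU * fnorm H ^+ 2)%:E + (Phi V + (gV - CV * fnorm K ^+ 2)%:E) + s1%:E)%E.
    rewrite addeACA -!EFinD -!addeA; congr (_ + (_ + _%:E))%E; ring.
  by apply: leeD => //; apply: leeD.
apply: le_trans step; apply: leeD2l; rewrite lee_fin sqr_pnorm /pdot /= -/H -/K.
rewrite mdotDl (mdotDl GV) -/gU -/gV.
have hHK : 0 <= (fnorm H - fnorm K) ^+ 2 by rewrite sqr_ge0.
have h1 : fnorm (residual U V) * (fnorm H * fnorm K)
    <= fnorm (residual U V) * (fnorm H ^+ 2 + fnorm K ^+ 2).
  rewrite ler_wpM2l //; move: (fnorm_ge0 H) (fnorm_ge0 K) hHK.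
  by move: (fnorm H) (fnorm K) => x y; nra.
have h2 : 0 <= CU * fnorm K ^+ 2 by rewrite mulr_ge0 ?sqr_ge0.
have h3 : 0 <= CV * fnorm H ^+ 2 by rewrite mulr_ge0 ?sqr_ge0.
lra.
Qed.

(** One constant dominating both the modulus of the quadratic minorant and the ratio of the
    subgradient to the step length, when [B] bounds the iterates and the proximal parameters. *)
Definition subgrad_bound (B : R) :=
  3 * B ^+ 2 + fnorm (As b) + lambda + 2 * B + 3 * `|alpha| * B ^+ 2.

Lemma fnorm_residual_le B U V : fnorm U <= B -> fnorm V <= B ->
  fnorm (residual U V) <= B ^+ 2 + fnorm (As b).
Proof.
move=> hU hV; rewrite residualE; apply: le_trans (fnormB _ _) _.
rewrite lerD2r fnorm_As; apply: le_trans (fnorm_A_le _) _.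
by rewrite expr2 fnorm_mulmx_le // fnorm_trmx.
Qed.

Lemma fnorm_residualB_le B U V X Y : fnorm V <= B -> fnorm X <= B ->
  fnorm (residual U V - residual X Y) <= B * (fnorm (U - X) + fnorm (V - Y)).
Proof.
move=> hV hX.
have -> : residual U V - residual X Y = As (A ((U - X) *m V^T + X *m (V - Y)^T)).
  rewrite !residualE opprB addrA subrK -linearB -linearB; congr (As (A _)).
  by rewrite mulmxBl linearB /= mulmxBr addrA subrK.
rewrite fnorm_As; apply: le_trans (fnorm_A_le _) _.
apply: le_trans (fnormD _ _) _; rewrite mulrDr; apply: lerD.
  by rewrite mulrC fnorm_mulmx_le ?fnorm_trmx.
by rewrite fnorm_mulmx_le ?fnorm_trmx.
Qed.

(** Optimality of the updates uses gradients at old points, while the subgradient is wanted at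
    [(U, V)]. The mismatch consists of differences only, hence is proportional to the step. *)
Lemma step_prox_subgrad B Xk Yk mu sigma U V :
  alpha != 0 -> beta != 0 -> alpha^-1 + beta^-1 = 1 -> 0 <= lambda ->
  fnorm Xk <= B -> fnorm Yk <= B -> fnorm U <= B -> fnorm V <= B ->
  `|mu| <= B -> `|sigma| <= B ->
  let Zk := Zupd A As b alpha beta Xk Yk in
  U_update Psi lambda alpha Xk Yk Zk mu U ->
  V_update Phi lambda alpha Yk Zk U sigma V ->
  exists2 G, pnorm G <= subgrad_bound B * (fnorm (U - Xk) + fnorm (V - Yk)) &
    prox_subgrad2 (subgrad_bound B) F (U, V) G.
Proof.
move=> a0 b0 ab l0 hX hY hU hV hmu hsg Zk updU /V_update_U_update updV.
have B0 : 0 <= B by apply: le_trans hX.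
have [T hT pU] := U_update_prox_subgrad updU.
have [T' hT' pV] := U_update_prox_subgrad updV.
have {}hT : fnorm T <= B ^+ 2.
  by apply: le_trans hT _; rewrite ler_pXn2r ?nnegrE.
have {}hT' : fnorm T' <= B ^+ 2.
  by apply: le_trans hT' _; rewrite ler_pXn2r ?nnegrE.
have Zres : alpha *: (Xk *m Yk^T - Zk) = residual Xk Yk.
  by rewrite scale_Zupd_residual.
set G1 := - _ in pU; set G2 := - _ in pV.
have CU0 (x : R) (M : 'M[R]_(n, r)) : 0 <= (`|alpha| * fnorm M ^+ 2 + `|lambda| + `|x|) / 2.
  by rewrite mulr_ge0 ?invr_ge0 // !addr_ge0 // mulr_ge0 ?sqr_ge0.
have := Fobj_prox_subgrad l0 pU pV (CU0 _ _) (CU0 _ _).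
set G := (X in prox_subgrad2 _ _ _ X); set C := (X in prox_subgrad2 X _ _ _) => pG.
set E1 := residual U V in G C pG *; set E0 := residual Xk Yk in Zres *.
have hE0 : fnorm E0 <= B ^+ 2 + fnorm (As b) by exact: fnorm_residual_le.
have hE1 : fnorm E1 <= B ^+ 2 + fnorm (As b) by exact: fnorm_residual_le.
have hE10 := fnorm_residualB_le U Yk hV hX; rewrite -/E1 -/E0 in hE10.
set dx := fnorm (U - Xk) in hE10 *; set dy := fnorm (V - Yk) in hE10 *.
have dx0 : 0 <= dx by exact: fnorm_ge0.
have dy0 : 0 <= dy by exact: fnorm_ge0.
have b00 : 0 <= fnorm (As b) by [].
have a00 := normr_ge0 alpha.
have B20 : 0 <= B ^+ 2 by rewrite sqr_ge0.
have aB0 : 0 <= `|alpha| * B ^+ 2 by rewrite mulr_ge0.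
exists G.
  apply: le_trans (pnorm_le _) _.
  (* After [E0 *m Yk] is matched against [E1 *m V], every remaining term carries a factor [E1 - E0],
     [V - Yk] or [U - Xk]. *)
  have G1E : G.1 = (E1 - E0) *m V + E0 *m (V - Yk) - lambda *: (V - Yk)
     - mu *: (U - Xk) - alpha *: ((U - Xk) *m T).
    rewrite /G /G1 /= scalerDr (scalemxAl alpha) Zres (mulmxBl E1) (mulmxBr E0).
    move: (E1 *m V) (E0 *m Yk) (E0 *m V) ((U - Xk) *m T) => P1 P2 P3 P4.
    by apply/matrixP => i j; rewrite !mxE; ring.
  have G2E : G.2 = (E1 - E0)^T *m U - alpha *: (Yk *m (U - Xk)^T *m U)
     - alpha *: ((V - Yk) *m T') - sigma *: (V - Yk).
    rewrite /G /G2 /= scalerDr scalemxAl.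
    (* [V] is computed after [U], but with a [Zk] built from [Xk]; the last summand corrects for
       this. *)
    have -> : alpha *: (Yk *m U^T - Zk^T) = E0^T + alpha *: (Yk *m (U - Xk)^T).
      rewrite -Zres linearZ /= -scalerDr; congr (_ *: _).
      rewrite [(_ - Zk)^T]linearB /= trmx_mul trmxK [(U - Xk)^T]linearB /= mulmxBr.
      by rewrite [RHS]addrC addrA subrK.
    rewrite [(E1 - E0)^T]linearB /= (mulmxBl E1^T) (mulmxDl E0^T) -scalemxAl.
    move: (E1^T *m U) (E0^T *m U) (Yk *m _ *m U) ((V - Yk) *m T') => P1 P2 P3 P4.
    by apply/matrixP => i j; rewrite !mxE; ring.
  have hG1 : fnorm G.1 <= B * (dx + dy) * B + (B ^+ 2 + fnorm (As b)) * dy + lambda * dy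
      + B * dx + `|alpha| * (dx * B ^+ 2).
    rewrite G1E; apply: le_trans (fnormB _ _) _; apply: lerD; last first.
      by rewrite fnormZ ler_wpM2l // fnorm_mulmx_le.
    apply: le_trans (fnormB _ _) _; apply: lerD; last first.
      by rewrite fnormZ ler_wpM2r.
    apply: le_trans (fnormB _ _) _; apply: lerD; last first.
      by rewrite fnormZ ger0_norm.
    by apply: le_trans (fnormD _ _) _; apply: lerD; apply: fnorm_mulmx_le.
  have hG2 : fnorm G.2 <= B * (dx + dy) * B + `|alpha| * (B * dx * B)
     + `|alpha| * (dy * B ^+ 2) + B * dy.
    rewrite G2E; apply: le_trans (fnormB _ _) _; apply: lerD; last first.
      by rewrite fnormZ ler_wpM2r.
    apply: le_trans (fnormB _ _) _; apply: lerD; last first.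
      by rewrite fnormZ ler_wpM2l // fnorm_mulmx_le.
    apply: le_trans (fnormB _ _) _; apply: lerD; last first.
      rewrite fnormZ ler_wpM2l // fnorm_mulmx_le // fnorm_mulmx_le //.
      by rewrite fnorm_trmx.
    by apply: fnorm_mulmx_le => //; rewrite fnorm_trmx.
  apply: le_trans (lerD hG1 hG2) _; rewrite /subgrad_bound.
  have p1 := mulr_ge0 B20 dx0; have p2 := mulr_ge0 b00 dx0.
  have p3 := mulr_ge0 l0 dx0; have p4 := mulr_ge0 B0 dx0.
  have p5 := mulr_ge0 B0 dy0; have p6 := mulr_ge0 aB0 dx0.
  have p7 := mulr_ge0 aB0 dy0; have p8 := mulr_ge0 B20 dy0.
  lra.
move=> W; apply: le_trans (pG W); apply: leeD2l; rewrite lee_fin lerD2l lerN2.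
rewrite ler_wpM2r ?sqr_ge0 // /C /subgrad_bound.
have hY2 : `|alpha| * fnorm Yk ^+ 2 <= `|alpha| * B ^+ 2.
  by rewrite ler_wpM2l // ler_pXn2r ?nnegrE.
have hU2 : `|alpha| * fnorm U ^+ 2 <= `|alpha| * B ^+ 2.
  by rewrite ler_wpM2l // ler_pXn2r ?nnegrE.
rewrite (ger0_norm l0); lra.
Qed.

End ObjectiveSubgradient.

(** * Line search *)

Section LineSearchBounds.
Variable R : realType.

(** The linear bound by [K] makes the set under [sup] bounded, so that [sup] is an upper bound and
    not a default value. *)
Lemma ler_opnorm m n m' n' (T : 'M[R]_(m, n) -> 'M[R]_(m', n')) K M :
  (forall N, fnorm (T N) <= K * fnorm N) -> fnorm M <= 1 ->
  fnorm (T M) <= opnorm T.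
Proof.
move=> TK M1; apply: ub_le_sup; last by exists M.
exists `|K| => _ [N /= N1 <-]; apply: le_trans (TK N) _.
apply: (@le_trans _ _ (`|K| * fnorm N)); first by rewrite ler_wpM2r ?ler_norm.
by rewrite -[leRHS]mulr1 ler_wpM2l.
Qed.

Lemma specnorm_ge0 m n (Y : 'M[R]_(m, n)) : 0 <= specnorm Y.
Proof.
apply: le_trans (ler_opnorm (M := 0) (fnormM Y) _); last by rewrite fnorm0.
by rewrite mulmx0 fnorm0.
Qed.

Lemma specnorm_le_fnorm m n (Y : 'M[R]_(m, n)) : specnorm Y <= fnorm Y.
Proof.
apply: ge_sup; first by exists (fnorm (Y *m (0 : 'cV[R]_n))), 0; rewrite //= fnorm0.
move=> _ [x /= x1 <-]; apply: le_trans (fnormM _ _) _.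
by rewrite -[leRHS]mulr1 ler_wpM2l.
Qed.

Lemma mdot_delta m n (i : 'I_m) (j : 'I_n) :
  mdot (delta_mx i j : 'M[R]_(m, n)) (delta_mx i j) = 1.
Proof.
rewrite /mdot (bigD1 i) //= (bigD1 j) //= big1 => [|k /negPf kj].
  rewrite big1 ?addr0 ?mxE ?eqxx ?mulr1 // => k /negPf ki.
  by apply: big1 => l _; rewrite mxE ki mul0r.
by rewrite mxE kj andbF mul0r.
Qed.

Variables (n r q : nat).
Variables (Psi Phi : 'M[R]_(n, r) -> \bar R).
Variables (A : {linear 'M[R]_n -> 'cV[R]_q}) (As : {linear 'cV[R]_q -> 'M[R]_n}).
Variables (b : 'cV[R]_q) (lambda alpha beta mumin sigmin sigmax tau c gamma : R).
Hypothesis adjA : is_adjoint A As.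
Hypothesis AAs : forall v, A (As v) = v.
Hypotheses (alpha0 : alpha != 0) (beta0 : beta != 0).
Hypothesis alphabeta : alpha^-1 + beta^-1 = 1.
Hypotheses (gamma0 : 0 <= gamma) (c0 : 0 < c) (mumin0 : 0 < mumin).
Hypotheses (sigmin0 : 0 < sigmin) (tau1 : 1 < tau).
Hypothesis psdA : psd_op (fun M => (alpha + gamma) *: M + beta *: As (A M)).

Local Notation T := (Tmap A As alpha beta).
Local Notation rho := (rho A As alpha beta).
Local Notation cap := (prox_cap A As alpha beta c gamma).

Lemma fnorm_Tmap_le M : fnorm (T M) <= (1 + `|beta / (alpha + beta)|) * fnorm M.
Proof.
apply: le_trans (fnormB _ _) _; rewrite mulrDl mul1r lerD2l fnormZ.
by rewrite ler_wpM2l // (fnorm_As adjA AAs) (fnorm_A_le adjA AAs).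
Qed.

Lemma rho_ge0 : 0 <= rho.
Proof. exact: sqr_ge0. Qed.

Lemma sqr_le_rho M k : fnorm M = 1 -> 0 <= k -> T M = k *: M -> k ^+ 2 <= rho.
Proof.
move=> M1 k0 TM; rewrite /rho /Defs.rho.
have : fnorm (T M) <= opnorm T by apply: ler_opnorm fnorm_Tmap_le _; rewrite M1.
rewrite TM fnormZ M1 mulr1 ger0_norm // => h.
by rewrite ler_pXn2r ?nnegrE // (le_trans k0 h).
Qed.

(* If [alpha < 0] then [0 < beta < 1], and testing [psdA] on a unit vector of
   the range of [As] (or of the kernel of [A], if that range is trivial)
   bounds [gamma] below, while [Tmap] acts there as [1 / beta] (or as 1). *)
Lemma prox_cap_coef_ge0 : (0 < n)%N -> 0 <= alpha + 2 * gamma * rho.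
Proof.
move=> n0; have g0 := gamma0; have r0 := rho_ge0.
have [a0|a0] := leP 0 alpha; first by rewrite addr_ge0 // mulr_ge0 // mulr_ge0.
have abE : alpha + beta = alpha * beta.
  by rewrite -[RHS]mulr1 -alphabeta; field; rewrite alpha0 beta0.
have hbi : beta^-1 = 1 - alpha^-1 by have := alphabeta; lra.
have ai0 : alpha^-1 < 0 by rewrite invr_lt0.
have bi1 : 1 < beta^-1 by rewrite hbi; lra.
have b0 : 0 < beta by rewrite -invr_gt0; lra.
case: (posnP q) => [q0|q0].
  have A0 M : A M = 0.
    by apply/matrixP; case=> k kq; exfalso; move: kq; rewrite q0.
  pose M : 'M[R]_n := delta_mx (Ordinal n0) (Ordinal n0).
  have MM : mdot M M = 1 by rewrite mdot_delta.
  have := psdA M; rewrite A0 linear0 scaler0 addr0 mdotZr MM mulr1 => ag.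
  have : 1 ^+ 2 <= rho.
    apply: (@sqr_le_rho M) => //; first by rewrite /fnorm MM sqrtr1.
    by rewrite /Tmap A0 linear0 scaler0 subr0 scale1r.
  rewrite expr1n => r1; have := ler_wpM2l g0 r1; lra.
pose v : 'cV[R]_q := delta_mx (Ordinal q0) 0.
have MM : mdot (As v) (As v) = 1 by rewrite -adjA AAs mdot_delta.
have := psdA (As v); rewrite AAs mdotDr !mdotZr MM !mulr1 => ag.
have r1 : beta^-1 ^+ 2 <= rho.
  apply: (@sqr_le_rho (As v)); first by rewrite /fnorm MM sqrtr1.
    by rewrite invr_ge0 ltW.
  rewrite /Tmap AAs -{1}[As v]scale1r -scalerBl abE hbi; congr (_ *: _).
  by field; rewrite alpha0 beta0.
(* Together: [gamma * rho >= - alpha / beta >= - alpha], hence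
   [alpha + 2 * gamma * rho >= - alpha > 0]. *)
have h1 : - (alpha * beta) <= gamma by lra.
have h2 := ler_wpM2l g0 r1.
have h3 : - (alpha * beta) * beta^-1 ^+ 2 <= gamma * beta^-1 ^+ 2.
  by rewrite ler_wpM2r ?sqr_ge0.
have h4 : - (alpha * beta) * beta^-1 ^+ 2 = - alpha * beta^-1.
  by field.
have h5 : - alpha * 1 <= - alpha * beta^-1 by rewrite ler_wpM2l ?oppr_ge0 // ltW.
lra.
Qed.

(** For [n = 0] there is no unit vector to test with, but then the spectral norm vanishes and the
    cap is [c]. *)
Lemma prox_cap_gt0 (Y : 'M[R]_(n, r)) : 0 < cap Y.
Proof.
rewrite /prox_cap; case: (posnP n) => [n0|/prox_cap_coef_ge0 h]; last first.
  by rewrite ltr_wpDl // mulr_ge0 // sqr_ge0.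
have Y0 : fnorm Y = 0.
  rewrite /fnorm /mdot big1 ?sqrtr0 //; case=> k kn.
  by exfalso; move: kn; rewrite n0.
have -> : specnorm Y = 0.
  by apply/eqP; rewrite eq_le specnorm_ge0 andbT -Y0 specnorm_le_fnorm.
by rewrite expr0n mulr0 add0r.
Qed.

Definition cap_bound (B : R) := `|alpha + 2 * gamma * rho| * B ^+ 2 + c.

Lemma prox_cap_le (Y : 'M[R]_(n, r)) B : fnorm Y <= B -> cap Y <= cap_bound B.
Proof.
move=> YB; have sB := le_trans (specnorm_le_fnorm Y) YB.
rewrite lerD2r; apply: (@le_trans _ _ (`|alpha + 2 * gamma * rho| * specnorm Y ^+ 2)).
  by rewrite ler_wpM2r ?sqr_ge0 ?ler_norm.
rewrite ler_wpM2l // ler_pXn2r ?nnegrE ?specnorm_ge0 //.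
exact: le_trans (specnorm_ge0 _) sB.
Qed.

Scheme ls_U_minimality := Minimality for ls_U Sort Prop
  with ls_V_minimality := Minimality for ls_V Sort Prop.
Combined Scheme ls_mutual_ind from ls_U_minimality, ls_V_minimality.

Local Notation ls_V' :=
  (ls_V Psi Phi A As b lambda alpha beta tau c gamma).

(* While [mu] has not reached its cap, [mu] and [sigma] are multiplied by the
   same powers of [tau], so the ratio [sigma / mu] is preserved. *)
Lemma ls_V_bounds Rk Xk Yk mu0 sigma0 mu sigma U :
  mumin <= mu0 -> sigmin <= sigma0 <= sigmax ->
  ls_V' Rk Xk Yk mu0 sigma0 mu sigma U ->
  0 < mu <= cap Yk /\
  0 < sigma <= sigmax + sigmax / mumin * (tau * cap Yk) + cap U.
Proof.
move=> hmu0 /andP[hs0 hs1].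
have capY := prox_cap_gt0 Yk.
have sigmax0 : 0 < sigmax by apply: lt_le_trans hs1; apply: lt_le_trans hs0.
set q0 := sigmax / mumin; have q00 : 0 < q0 by rewrite divr_gt0.
have tau0 : 0 < tau by apply: lt_trans tau1.
(* Initially [sigma <= sigmax], whereas [mu0] has no upper bound; after an increase [mu] is at most
   [tau] times its cap, and the ratio bounds [sigma]. Once [mu] sits at its cap the ratio is lost,
   but each later increase truncates [sigma] at [cap U]. *)
pose PU mu sigma := [/\ 0 < mu, 0 < sigma, sigma <= q0 * mu
  & sigma <= sigmax \/ mu <= tau * cap Yk].
pose PV mu sigma (U : 'M[R]_(n, r)) := [/\ 0 < mu <= cap Yk, 0 < sigma,
  mu <> cap Yk -> sigma <= q0 * mu
  & sigma <= sigmax + q0 * (tau * cap Yk) + cap U].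
suff [_ H] : (forall mu sigma,
    ls_U Psi Phi A As b lambda alpha beta tau c gamma Rk Xk Yk mu0 sigma0 mu sigma ->
    PU mu sigma) /\
  (forall mu sigma U, ls_V' Rk Xk Yk mu0 sigma0 mu sigma U -> PV mu sigma U).
  by case/H => -> -> _ ->.
apply: ls_mutual_ind => [|m s W V _ [/andP[m0 mc] s0 ms _] _ _ /[dup] mcap /ms sm
    |m s W _ [m0 s0 sm hs] _|m s W V _ [/andP[m0 mc] s0 ms _] _ _ mcap].
- have mu00 := lt_le_trans mumin0 hmu0.
  split => //; [exact: lt_le_trans hs0| |by left].
  apply: le_trans hs1 _; rewrite /q0 -mulrA -[leLHS]mulr1 ler_pM2l //.
  by rewrite ler_pdivlMl // mulr1.
- split; [exact: mulr_gt0|exact: mulr_gt0| |right].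
    by rewrite mulrCA ler_pM2l.
  by rewrite ler_pM2l.
- have capW := prox_cap_gt0 W.
  have qt0 : 0 < q0 * (tau * cap Yk) by rewrite mulr_gt0 // mulr_gt0.
  split => //.
  + by rewrite lt_min m0 capY ge_min lexx orbT.
  + by case: (leP m (cap Yk)) => [mc _|//]; exact: sm.
  + case: hs => hs; first lra.
    have := le_trans sm (ler_wpM2l (ltW q00) hs); lra.
- have capW := prox_cap_gt0 W.
  have qt0 : 0 < q0 * (tau * cap Yk) by rewrite mulr_gt0 // mulr_gt0.
  split => //; first by rewrite m0 mc.
    by rewrite lt_min capW mulr_gt0.
  rewrite ge_min; apply/orP; right; lra.
Qed.

Lemma ANAUM_step_accept Rk Xk Yk U V :
  ANAUM_step Psi Phi A As b lambda alpha beta mumin sigmin sigmax tau c gamma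
    Rk Xk Yk U V ->
  ls_accept Psi Phi A b lambda c Rk Xk Yk U V.
Proof. by case=> [? [? [? [? [_ _ []]]]]]. Qed.

(** The constant depends on the bound [B] alone, not on the iteration or the initial line search
    parameters. *)
Lemma ANAUM_step_prox_subgrad B : 0 <= lambda -> 0 <= B ->
  exists2 K, 0 <= K & forall Rk Xk Yk U V,
    fnorm Xk <= B -> fnorm Yk <= B -> fnorm U <= B -> fnorm V <= B ->
    ANAUM_step Psi Phi A As b lambda alpha beta mumin sigmin sigmax tau c gamma
      Rk Xk Yk U V ->
    exists2 G, pnorm G <= K * (fnorm (U - Xk) + fnorm (V - Yk)) &
      prox_subgrad2 K (Fobj Psi Phi A b lambda) (U, V) G.
Proof.
move=> l0 B0; have cB0 : 0 <= cap_bound B.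
  by rewrite addr_ge0 ?mulr_ge0 ?sqr_ge0 // ltW.
pose B' := B + cap_bound B + `|sigmax| + `|sigmax| / mumin * (tau * cap_bound B).
have t0 : 0 <= tau by apply: ltW; apply: lt_trans tau1.
have B1 : 0 <= `|sigmax| / mumin * (tau * cap_bound B).
  by rewrite !mulr_ge0 // invr_ge0 ltW.
have s0 := normr_ge0 sigmax.
have BB' : B <= B' by rewrite /B'; lra.
have cBB' : cap_bound B <= B' by rewrite /B'; lra.
exists (subgrad_bound As b lambda alpha B').
  rewrite /subgrad_bound; have B'0 := le_trans B0 BB'.
  by rewrite !addr_ge0 // !mulr_ge0 // sqr_ge0.
move=> Rk Xk Yk U V hX hY hU hV [mu0 [sigma0 [mu [sigma [hmu0 hs0 [hls hV' _]]]]]].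
(* Increasing [sigma] alone changes neither [mu] nor [U], so the accepted [U] is an update for the
   final [mu]. *)
have updU : U_update Psi lambda alpha Xk Yk (Zupd A As b alpha beta Xk Yk) mu U.
  by elim: hls => {mu sigma U hV hU hV'} //.
have [/andP[mu_gt0 mu_le] /andP[sg0 sg]] := ls_V_bounds hmu0 hs0 hls.
have capY := prox_cap_le hY; have capU := prox_cap_le hU.
apply: (step_prox_subgrad adjA AAs (beta := beta) (mu := mu) (sigma := sigma)) => //;
  try exact: le_trans BB'.
  by rewrite gtr0_norm //; apply: le_trans mu_le _; apply: le_trans cBB'.
rewrite gtr0_norm //; apply: le_trans sg _.
have sigmax0 : 0 < sigmax.
  by case/andP: hs0 => h; apply: lt_le_trans; apply: lt_le_trans h.
have h2 : sigmax / mumin * (tau * cap Yk) <= sigmax / mumin * (tau * cap_bound B).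
  by rewrite !ler_wpM2l // divr_ge0 ?ltW.
rewrite /B' (gtr0_norm sigmax0); lra.
Qed.

End LineSearchBounds.

(** * Rates for real sequences *)

Section RealRates.
Variable R : realType.
Implicit Types (a b s C theta : R).

(** Young's inequality [a^theta * b^(1 - theta) <= theta * a + (1 - theta) * b]. This is the tangent
    inequality for the concave [t^(1 - theta)], multiplied by [a^theta] so that it also holds at
    [a = 0]. *)
Lemma powR_concave_diff a b theta : 0 <= a -> 0 <= b -> 0 < theta < 1 ->
  (1 - theta) * (a - b) <= a `^ theta * (a `^ (1 - theta) - b `^ (1 - theta)).
Proof.
move=> a0 b0 /andP[t0 t1].
have t1' : 0 < 1 - theta by rewrite subr_gt0.
rewrite [leRHS]mulrBr -powRD; last by rewrite addrC subrK oner_eq0.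
have -> : theta + (1 - theta) = 1 by ring.
rewrite powRr1 //.
have := @conjugate_powR R (a `^ theta) (b `^ (1 - theta)) theta^-1 (1 - theta)^-1
  (powR_ge0 _ _) (powR_ge0 _ _).
rewrite !invr_gt0 !invrK -!powRrM !mulfV ?gt_eqF // !powRr1 // => /(_ t0 t1').
have -> : theta + (1 - theta) = 1 by ring.
move=> /(_ erefl); lra.
Qed.

(** Discrete analogue of integrating [r' = - r^(1 + s) / C]. With [t = b / a], [t^(- s) >= 1 - s *
    ln t >= 1 + s * (1 - t)]; then multiply by [a^(- s)]. *)
Lemma powRN_growth a b s C : 0 < b <= a -> 0 < s -> 0 < C ->
  a `^ (1 + s) <= C * (a - b) -> a `^ (- s) + s / C <= b `^ (- s).
Proof.
move=> /andP[b0 ba] s0 C0 h; have a0 : 0 < a by exact: lt_le_trans ba.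
have as0 : 0 < a `^ s by exact: powR_gt0.
have t0 : 0 < b / a by rewrite divr_gt0.
have -> : b `^ (- s) = a `^ (- s) * (b / a) `^ (- s).
  by rewrite -powRM ?ltW // mulrC divfK ?gt_eqF.
have ht : 1 + s * (1 - b / a) <= (b / a) `^ (- s).
  rewrite /powR gt_eqF //; apply: le_trans (expR_ge1Dx _).
  rewrite lerD2l mulNr -mulrN ler_pM2l //.
  have : ln (1 + (b / a - 1)) <= b / a - 1 by apply: le_ln1Dx; lra.
  have -> : 1 + (b / a - 1) = b / a by ring.
  lra.
have := ler_wpM2l (powR_ge0 a (- s)) ht; apply: le_trans.
rewrite mulrDr mulr1 lerD2l powRN mulrCA ler_pM2l //.
have aE : a `^ (1 + s) = a * a `^ s.
  by rewrite powRD ?powRr1 ?(ltW a0) // (gt_eqF a0) implybT.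
rewrite aE in h.
have -> : (a `^ s)^-1 * (1 - b / a) = (a - b) / (a * a `^ s).
  by field; rewrite !gt_eqF.
by rewrite ler_pdivlMr ?mulr_gt0 // mulrC ler_pdivrMr // [leRHS]mulrC.
Qed.

Section Sequences.
Variables (e d r : nat -> R) (N : nat) (theta C : R).
Hypotheses (theta_ge : 1 / 2 <= theta) (theta_lt1 : theta < 1) (C0 : 0 < C).
Hypotheses (d0 : forall k, 0 <= d k) (r0 : forall k, 0 <= r k).
Hypothesis r_dec : forall k, r k.+1 <= r k.
Hypothesis sqr_d : forall k, d k ^+ 2 <= C * (r k - r k.+1).
Hypothesis r_KL : forall k, (N <= k)%N -> r k `^ (2 * theta) <= C * (r k - r k.+1).
Hypothesis e_d : forall k, e k <= e k.+1 + d k.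
Hypothesis e_cvg0 : e @ \oo --> 0.

Let theta01 : 0 < theta < 1.
Proof. by apply/andP; split => //; move: theta_ge; lra. Qed.

(** Multiplying [sqr_d] by [r_KL] and taking roots bounds [d k * r k ^ theta] by
    [C * (r k - r k.+1)]; concavity bounds this difference by a multiple of [r k ^ theta], which
    cancels. If [r k = 0], both sides vanish. *)
Lemma step_le_powR_diff k : (N <= k)%N ->
  d k <= C / (1 - theta) * (r k `^ (1 - theta) - r k.+1 `^ (1 - theta)).
Proof.
move=> Nk; have t1 : 0 < 1 - theta by rewrite subr_gt0.
have [rk0|rk0] := eqVneq (r k) 0.
  have rS : r k.+1 = 0.
    by apply/eqP; rewrite eq_le r0 andbT -rk0 r_dec.
  have := sqr_d k; rewrite rk0 rS subrr mulr0 => h.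
  have : d k ^+ 2 == 0 by rewrite eq_le h sqr_ge0.
  by rewrite sqrf_eq0 => /eqP ->; rewrite subrr mulr0.
have rkp : 0 < r k by rewrite lt_def rk0 r0.
have rt0 : 0 < r k `^ theta by exact: powR_gt0.
have hrd : d k * r k `^ theta <= C * (r k - r k.+1).
  have nn : 0 <= C * (r k - r k.+1) by rewrite mulr_ge0 ?subr_ge0 // ltW.
  rewrite -(@ler_pXn2r _ 2) // ?nnegrE ?mulr_ge0 ?powR_ge0 //.
  rewrite exprMn [leRHS]expr2; apply: ler_pM; rewrite ?sqr_ge0 //.
  have -> : (r k `^ theta) ^+ 2 = r k `^ (2 * theta).
    by rewrite mulrC powRrM powR_mulrn ?powR_ge0.
  exact: r_KL.
have := powR_concave_diff (r0 k) (r0 k.+1) theta01.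
set D := r k `^ (1 - theta) - _ => hD.
rewrite mulrAC ler_pdivlMr // -(ler_pM2r rt0).
have h1 := ler_wpM2r (ltW t1) hrd; have h2 := ler_wpM2l (ltW C0) hD.
lra.
Qed.

(** The step bounds telescope from [k] to [k + m], and [e (k + m)] vanishes as [m] grows. *)
Lemma dist_le_powR k : (N <= k)%N ->
  e k <= C / (1 - theta) * r k `^ (1 - theta).
Proof.
move=> Nk; set K := C / (1 - theta).
have K0 : 0 <= K by rewrite divr_ge0 ?subr_ge0 ?ltW.
have H m : e k <=
    e (k + m)%N + K * (r k `^ (1 - theta) - r (k + m)%N `^ (1 - theta)).
  elim: m => [|m IH]; first by rewrite addn0 subrr mulr0 addr0.
  apply: le_trans IH _; rewrite addnS.
  have := e_d (k + m)%N; have := step_le_powR_diff (leq_trans Nk (leq_addr m k)).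
  rewrite -/K; lra.
have H' m : e k - K * r k `^ (1 - theta) <= e (k + m)%N.
  have := mulr_ge0 K0 (powR_ge0 (r (k + m)%N) (1 - theta)).
  have := H m; lra.
rewrite -subr_le0; have := e_cvg0; rewrite -(cvg_shiftn k) => ecvg.
apply: (cvgr_to_ge ecvg).
by near=> m; rewrite /= addnC.
Unshelve. all: by end_near. Qed.

Lemma linear_rate : theta = 1 / 2 -> exists d1 varrho,
  [/\ 0 < d1, 0 < varrho < 1 & \forall k \near \oo, e k <= d1 * varrho ^+ k].
Proof.
(* Enlarging [C] beyond 1 puts the contraction factor [1 - 1 / C'] of the gap strictly between 0 and
   1. *)
move=> thetaE; pose C' := C + 1.
have C'1 : 1 < C' by rewrite /C' ltrDr.
have C'0 : 0 < C' by exact: lt_trans C'1.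
pose p := 1 - C'^-1; have p0 : 0 < p by rewrite subr_gt0 invf_lt1.
have p1 : p < 1 by rewrite /p ltrBlDr ltrDl invr_gt0.
have hr k : (N <= k)%N -> r k.+1 <= p * r k.
  move=> Nk; have := r_KL Nk; rewrite thetaE.
  have -> : (2 * (1 / 2) = 1 :> R) by field.
  rewrite powRr1 // => h.
  have : r k <= C' * (r k - r k.+1).
    by apply: le_trans h _; rewrite ler_wpM2r ?subr_ge0 // /C' lerDl.
  rewrite -ler_pdivrMl // /p; lra.
have hrN m : r (N + m)%N <= p ^+ m * r N.
  elim: m => [|m IH]; first by rewrite addn0 expr0 mul1r.
  rewrite addnS exprS -mulrA; apply: le_trans (hr _ (leq_addr _ _)) _.
  by rewrite ler_pM2l.
pose v := Num.sqrt p.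
have v0 : 0 < v by rewrite sqrtr_gt0.
have v1 : v < 1 by rewrite -sqrtr1 ltr_sqrt.
pose K := C / (1 - theta).
have K0 : 0 < K by rewrite divr_gt0 ?subr_gt0.
(* The distance behaves like the square root of the gap, hence the rate [sqrt p]. Dividing by
   [v ^+ N] shifts the exponent from [k - N] to [k]; the 1 keeps the constant positive when
   [r N = 0]. *)
exists (K * Num.sqrt (r N) / v ^+ N + 1), v; split.
- rewrite ltr_wpDl // divr_ge0 ?exprn_ge0 ?(ltW v0) //.
  by rewrite mulr_ge0 ?sqrtr_ge0 ?(ltW K0).
- by rewrite v0 v1.
near=> k; have Nk : (N <= k)%N by near: k; exact: nbhs_infty_ge.
apply: le_trans (dist_le_powR Nk) _; rewrite -/K.
have -> : 1 - theta = 2^-1 by rewrite thetaE; field.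
rewrite powR12_sqrt //.
have h1 : Num.sqrt (r k) <= v ^+ (k - N) * Num.sqrt (r N).
  have := hrN (k - N)%N; rewrite subnKC // => h.
  apply: le_trans (ler_wsqrtr h) _.
  rewrite sqrtrM ?exprn_ge0 ?(ltW p0) //.
  suff -> : Num.sqrt (p ^+ (k - N)) = v ^+ (k - N) by [].
  rewrite -{1}(sqr_sqrtr (ltW p0)) -exprM mulnC exprM sqrtr_sqr.
  by rewrite ger0_norm // exprn_ge0 // sqrtr_ge0.
have h2 : v ^+ (k - N) = v ^+ k / v ^+ N.
  by rewrite -[in RHS](subnKC Nk) exprD mulrC mulKf // expf_neq0 ?gt_eqF.
apply: le_trans (ler_wpM2l (ltW K0) h1) _; rewrite h2 mulrDl mul1r.
rewrite ler_wpDr ?exprn_ge0 ?(ltW v0) //.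
by rewrite le_eqVlt; apply/orP; left; apply/eqP; ring.
Unshelve. all: by end_near. Qed.

Lemma sublinear_rate : 1 / 2 < theta -> exists2 d2, 0 < d2 &
  \forall k \near \oo, e k <= d2 * k%:R `^ (- ((1 - theta) / (2 * theta - 1))).
Proof.
move=> theta_gt; pose s := 2 * theta - 1.
have s0 : 0 < s by rewrite /s; lra.
have t1 : 0 < 1 - theta by rewrite subr_gt0.
pose K := C / (1 - theta).
have K0 : 0 < K by rewrite divr_gt0.
have sC : 0 < s / C by rewrite divr_gt0.
pose p := (1 - theta) / s.
have p0 : 0 <= p by rewrite divr_ge0 ?ltW.
(* With [1 + s = 2 * theta], each step adds at least [s / C] to [r ^ (- s)] as long as the gap stays
   positive. *)
have rgrow m : 0 < r (N + m)%N -> m%:R * (s / C) <= r (N + m)%N `^ (- s).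
  elim: m => [|m IH]; first by rewrite mul0r powR_ge0.
  rewrite addnS => rS; have rm : 0 < r (N + m)%N by exact: lt_le_trans (r_dec _).
  rewrite -natr1 mulrDl mul1r.
  apply: le_trans (lerD (IH rm) (lexx _)) _.
  apply: powRN_growth => //; first by rewrite rS r_dec.
  by rewrite /s subrKC r_KL ?leq_addr.
exists (K * (2 * (C / s)) `^ p).
  by rewrite mulr_gt0 // powR_gt0 // mulr_gt0 // divr_gt0.
near=> k.
(* This gives [k - N >= k / 2], whence the factor 2 in the constant, and [k > 0]. *)
have Nk2 : (2 * N + 1 <= k)%N by near: k; exact: nbhs_infty_ge.
have Nk : (N <= k)%N.
  by apply: leq_trans Nk2; rewrite mul2n -addnn -addnA leq_addr.
have k0 : 0 < k%:R :> R.
  by rewrite ltr0n; apply: leq_trans Nk2; rewrite addn1.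
apply: le_trans (dist_le_powR Nk) _; rewrite -/K -/p -[leRHS]mulrA ler_pM2l //.
have [rk0|rk0] := eqVneq (r k) 0.
  by rewrite rk0 powR0 ?gt_eqF // mulr_ge0 // powR_ge0.
have rkp : 0 < r k by rewrite lt_def rk0 r0.
have := rgrow (k - N)%N; rewrite subnKC // => /(_ rkp) h.
have hk : k%:R / 2 <= (k - N)%:R :> R.
  rewrite ler_pdivrMr // -natrM ler_nat mulnBl leq_subRL ?leq_mul //.
  rewrite addnC !muln2 -(addnn k) leq_add2l -mul2n.
  exact: leq_trans (leq_addr 1 _) Nk2.
have h' : k%:R / 2 * (s / C) <= (r k `^ s)^-1.
  by rewrite -powRN; apply: le_trans h; rewrite ler_pM2r.
have rs0 : 0 < r k `^ s by exact: powR_gt0.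
have hr : r k `^ s <= 2 * (C / s) / k%:R.
  have : r k `^ s * (k%:R / 2 * (s / C)) <= 1.
    by rewrite mulrC -ler_pdivlMr // mul1r.
  have -> : 2 * (C / s) / k%:R = (k%:R / 2 * (s / C))^-1.
    by field; rewrite !gt_eqF.
  by rewrite -[X in _ -> _ <= X]mul1r ler_pdivlMr // mulr_gt0 // divr_gt0.
have -> : r k `^ (1 - theta) = (r k `^ s) `^ p.
  by rewrite -powRrM /p mulrC divfK ?gt_eqF.
have h2 : 0 <= 2 * (C / s) by rewrite mulr_ge0 // divr_ge0 // ltW.
apply: le_trans (ge0_ler_powR p0 _ _ hr) _; rewrite ?nnegrE ?powR_ge0 //.
  by rewrite divr_ge0 // ltW.
rewrite powRM ?invr_ge0 ?(ltW k0) // ler_wpM2l ?powR_ge0 //.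
by rewrite powRN -powR_inv1 ?(ltW k0) // -powRrM mulN1r powRN.
Unshelve. all: by end_near. Qed.

End Sequences.

(* Either the KL inequality controls [f] by the last step, or
   [f <= 0] and the averaging already contracts the gap [r]. *)
Lemma KL_gap_bound (f r' r theta1 theta K M p : R) :
  0 <= theta <= theta1 -> 1 / 2 <= theta1 < 1 -> 0 < p <= 1 ->
  0 <= r' <= r -> r <= 1 -> 0 <= K -> 0 <= M -> f <= r ->
  r - f <= (r - r') / p ->
  (0 < f -> exists2 d, f `^ theta <= K * d & d ^+ 2 <= M * (r - r')) ->
  r `^ (2 * theta1) <= (4 * K ^+ 2 * M + 2 / p) * (r - r').
Proof.
move=> /andP[t0 tt1] /andP[t12 t11] /andP[p0 p1] /andP[r'0 r'r] r1 K0 M0 fr hf KL.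
have D0 : 0 <= r - r' by rewrite subr_ge0.
have r0 : 0 <= r by exact: le_trans r'r.
have t2 : 0 <= 2 * theta1 by lra.
have KM : 0 <= 4 * K ^+ 2 * M by rewrite !mulr_ge0 // sqr_ge0.
have Kp : 0 <= 2 / p by rewrite divr_ge0 // ltW.
(* In the first case [r] itself is at most [2 / p * (r - r')], and [r <= 1] allows the power
   [2 * theta1 >= 1]. In the second [f > 0] and [r <= 2 * f], so KL applies; 4 bounds
   [2 ^ (2 * theta1)]. *)
have [fD|fD] := leP f ((r - r') / p).
  have hr : r <= 2 / p * (r - r') by lra.
  apply: (@le_trans _ _ r).
    have [->|rn0] := eqVneq r 0; first by rewrite powR0 //; apply/eqP; lra.
    by apply: ge1r_powR; [rewrite lt_def rn0 r0 r1|lra].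
  by apply: le_trans hr _; rewrite ler_wpM2r // lerDr.
have f0 : 0 < f by apply: le_lt_trans fD; rewrite divr_ge0 // ltW.
have [d hd1 hd2] := KL f0.
have rf : r <= 2 * f by lra.
have hfd : f `^ theta1 <= K * d.
  by apply: le_trans hd1; apply: ger_powR => //; rewrite f0 (le_trans fr).
have hf2 : f `^ (2 * theta1) <= K ^+ 2 * M * (r - r').
  rewrite mulrC powRrM powR_mulrn ?powR_ge0 //.
  apply: (@le_trans _ _ ((K * d) ^+ 2)).
    by rewrite ler_pXn2r ?nnegrE ?powR_ge0 // (le_trans _ hfd) ?powR_ge0.
  by rewrite exprMn -mulrA ler_wpM2l ?sqr_ge0.
apply: le_trans (ge0_ler_powR t2 _ _ rf) _; rewrite ?nnegrE ?mulr_ge0 ?(ltW f0) //.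
rewrite powRM ?(ltW f0) //.
have h4 : 2 `^ (2 * theta1) <= 4 :> R.
  have -> : (4 = 2 `^ 2%:R :> R) by rewrite powR_mulrn // -natrX.
  by apply: ler_powR; lra.
apply: (@le_trans _ _ (4 * (K ^+ 2 * M * (r - r')))).
  by apply: ler_pM; rewrite ?powR_ge0.
have := mulr_ge0 Kp D0; lra.
Qed.

End RealRates.

(** * Descent under the KL inequality *)

Section KLConvergence.
Variables (R : realType) (n r : nat).
Local Notation E := ('M[R]_(n, r) * 'M[R]_(n, r))%type.
Implicit Types (h : E -> \bar R) (W G : E).

Lemma fnorm_cvg0 m p (X : nat -> 'M[R]_(m, p)) (L : 'M[R]_(m, p)) :
  X @ \oo --> L -> (fun k => fnorm (X k - L)) @ \oo --> (0 : R).
Proof.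
move=> XL; apply/cvgr0Pnorm_lt => e e0.
set K : R := (m * p)%:R + 1; have K0 : 0 < K by rewrite ltr_wpDl.
near=> k; rewrite ger0_norm //; apply: le_lt_trans (fnorm_le_mx_norm _) _.
rewrite -/K -ltr_pdivlMl // distrC; near: k.
by apply: cvgr_dist_lt => //; rewrite mulr_gt0 ?invr_gt0.
Unshelve. all: by end_near. Qed.

Lemma pnorm_near W (e : R) : 0 < e -> \forall W' \near W, pnorm (W' - W) < e.
Proof.
move=> e0; set K : R := (n * r)%:R + 1; have K0 : 0 < K by rewrite ltr_wpDl.
near=> W'.
have hW : `|W - W'| < e / (2 * K).
  by near: W'; apply: cvgr_dist_lt => //; rewrite divr_gt0 // mulr_gt0.
apply: le_lt_trans (pnorm_le _) _.
have h1 : fnorm (W' - W).1 <= K * `|W - W'|.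
  apply: le_trans (fnorm_le_mx_norm _) _; rewrite ler_pM2l // [leRHS]distrC.
  by rewrite prod_normE /= le_max lexx.
have h2 : fnorm (W' - W).2 <= K * `|W - W'|.
  apply: le_trans (fnorm_le_mx_norm _) _; rewrite ler_pM2l // [leRHS]distrC.
  by rewrite prod_normE /= le_max lexx orbT.
apply: le_lt_trans (lerD h1 h2) _; rewrite -mulrDl -mulr2n -mulr_natl.
by rewrite -ltr_pdivlMl ?mulr_gt0 // mulrC.
Unshelve. all: by end_near. Qed.

(** Within radius [eps / (C + 1)] the quadratic error is below [eps] times the distance. *)
Lemma prox_subgrad2_frechet C h W G : h W \is a fin_num -> 0 <= C ->
  prox_subgrad2 C h W G -> frechet_subdiff h W G.
Proof.
move=> hW C0 hG; split => // eps eps0.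
have C1 : 0 < C + 1 by rewrite ltr_wpDl.
near=> W'; apply: le_trans (hG W'); apply: leeD2l; rewrite lee_fin lerD2l lerN2.
rewrite expr2 mulrA ler_wpM2r ?sqrtr_ge0 //.
have hp : pnorm (W' - W) < eps / (C + 1).
  by near: W'; apply: pnorm_near; rewrite divr_gt0.
have p0 : 0 <= pnorm (W' - W) by exact: sqrtr_ge0.
move: hp; rewrite ltr_pdivlMr // => hp; nra.
Unshelve. all: by end_near. Qed.

Lemma frechet_subdiff_limiting h W G :
  frechet_subdiff h W G -> limiting_subdiff h W G.
Proof.
move=> hG; split; first by case: hG.
exists (fun=> W), (fun=> G); split => //; exact: cvg_cst.
Qed.

(** For [phi t = a * t^(1 - theta)] the KL inequality is solved for [t^theta]; the distance to the
    subdifferential is replaced by the norm of any chosen subgradient. *)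
Lemma KL_exponent_bound h theta W : 0 <= theta < 1 -> h W \is a fin_num ->
  KL_exponent_at h theta W ->
  exists (V : set E) (nu K : R), [/\ nbhs W V, 0 < nu, 0 <= K &
    forall W' (f : R), V W' -> h W' = f%:E -> fine (h W) < f < fine (h W) + nu ->
    forall G, limiting_subdiff h W' G ->
      (f - fine (h W)) `^ theta <= K * pnorm G].
Proof.
move=> /andP[t0 t1] hWfin [nu [V [phi [nu0 VW _ [a a0 phiE] KL]]]].
have t1' : 0 < 1 - theta by rewrite subr_gt0.
have [nu' nu'0 nuE] : exists2 nu' : R, 0 < nu' & (nu'%:E <= nu)%E.
  case: nu nu0 {phiE KL} => [nu|_|//]; last by exists 1; rewrite // leey.
  by exists nu.
exists V, nu', (a * (1 - theta)); split => //; first by rewrite mulr_ge0 // ltW.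
move=> W' f VW' hW' /andP[flt fgt] G hG.
set t := f - fine (h W); have tp : 0 < t by rewrite subr_gt0.
have tnu : (t%:E < nu)%E by apply: lt_le_trans nuE; rewrite lte_fin /t; lra.
(* [phi] is a power only on [[0, nu)], so the derivative is computed from equality near the interior
   point [t]. *)
have phi' : derive1 phi t = a * ((1 - theta) * t `^ (- theta)).
  rewrite derive1E (@near_eq_derive _ _ _ _ (fun z => a * z `^ (1 - theta))); last first.
    near=> z; apply: phiE.
      by apply: ltW; near: z; exact: lt_nbhsr.
    apply: lt_le_trans nuE; rewrite lte_fin; near: z; apply: lt_nbhsl.
    by rewrite /t; lra.
  pose g (z : R) : R := z `^ (1 - theta).
  have [dg gE] : is_derive t 1 g ((1 - theta) * t `^ (1 - theta - 1)).
    exact: is_derive1_powR.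
  rewrite (_ : (fun z : R => a * z `^ (1 - theta)) = a *: g) // deriveZ // gE.
  by rewrite addrAC subrr add0r.
have hWE : h W = (fine (h W))%:E by rewrite fineK.
have := KL W' VW'; rewrite hW' hWE lte_fin => /(_ flt).
have fnu : (f%:E < (fine (h W))%:E + nu)%E.
  apply: (@lt_le_trans _ _ ((fine (h W))%:E + nu'%:E)%E); first by rewrite -EFinD lte_fin.
  exact: leeD2l.
move=> /(_ fnu); rewrite -EFinB /= -/t phi' => h1.
have tt : 0 < t `^ theta by exact: powR_gt0.
have ca : 0 <= a * ((1 - theta) * t `^ (- theta)).
  by rewrite !mulr_ge0 ?powR_ge0 // ltW.
have h2 : (1 <= (a * ((1 - theta) * t `^ (- theta)))%:E * (pnorm G)%:E)%E.
  apply: le_trans h1 _; apply: lee_wpmul2l; first by rewrite lee_fin.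
  by apply: ereal_inf_lbound; exists G.
move: h2; rewrite -EFinM lee_fin powRN => h2.
have -> : a * (1 - theta) * pnorm G
    = a * ((1 - theta) / t `^ theta) * pnorm G * t `^ theta.
  by field; rewrite gt_eqF.
by rewrite -[leLHS]mul1r ler_wpM2r // ltW.
Unshelve. all: by end_near. Qed.

Lemma fnorm_le_pnorm (D : E) : fnorm D.1 <= pnorm D /\ fnorm D.2 <= pnorm D.
Proof.
by split; rewrite -(@ler_pXn2r _ 2) // ?nnegrE ?sqrtr_ge0 // sqr_pnorm
  ?lerDl ?lerDr sqr_ge0.
Qed.

Lemma norm_le_pnorm (D : E) : `|D| <= pnorm D.
Proof.
have [H1 H2] := fnorm_le_pnorm D; rewrite prod_normE /= ge_max.
by rewrite !(le_trans (mx_norm_le_fnorm _)).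
Qed.

Lemma pdot_ge (G D : E) : - (pnorm G * (fnorm D.1 + fnorm D.2)) <= pdot G D.
Proof.
have [H1 H2] := fnorm_le_pnorm G.
have := ler_wpM2r (fnorm_ge0 D.1) H1; have := ler_wpM2r (fnorm_ge0 D.2) H2.
have := normr_mdot G.1 D.1; have := normr_mdot G.2 D.2.
rewrite !ler_norml /pdot => /andP[? _] /andP[? _]; lra.
Qed.

End KLConvergence.

(** * Nonmonotone descent with averaged reference values *)

Section NonmonotoneDescent.
Variables (R : realType) (n r : nat).
Local Notation E := ('M[R]_(n, r) * 'M[R]_(n, r))%type.
Variables (h : E -> \bar R) (X Y : nat -> 'M[R]_(n, r)) (Xl Yl : 'M[R]_(n, r)).
Variables (Rs p : nat -> R) (c pmin K theta : R).
Hypotheses (h_proper : Defs.proper h) (h_lsc : lower_semicontinuous h).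
Hypothesis h_KL : forall W, limiting_subdiff h W !=set0 -> KL_exponent_at h theta W.
Hypotheses (theta01 : 0 <= theta < 1) (c0 : 0 < c) (pmin01 : 0 < pmin < 1).
Hypothesis K0 : 0 <= K.
Hypothesis Rs0 : (Rs 0%N)%:E = h (X 0%N, Y 0%N).
Hypothesis descent : forall k, (h (X k.+1, Y k.+1) - (Rs k)%:E <=
  (- (c / 2 * (fnorm (X k.+1 - X k) ^+ 2 + fnorm (Y k.+1 - Y k) ^+ 2)))%:E)%E.
Hypothesis p_range : forall k, pmin <= p k.+1 <= 1.
Hypothesis RsS : forall k, (Rs k.+1)%:E =
  (((1 - p k.+1) * Rs k)%:E + (p k.+1)%:E * h (X k.+1, Y k.+1))%E.
Hypothesis subgrad : forall k,
  exists2 G, pnorm G <= K * (fnorm (X k.+1 - X k) + fnorm (Y k.+1 - Y k)) &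
    prox_subgrad2 K h (X k.+1, Y k.+1) G.
Hypotheses (X_cvg : X @ \oo --> Xl) (Y_cvg : Y @ \oo --> Yl).

Let f k := fine (h (X k, Y k)).
Let d k := fnorm (X k.+1 - X k) + fnorm (Y k.+1 - Y k).
Let e k := fnorm (X k - Xl) + fnorm (Y k - Yl).
Let fl := fine (h (Xl, Yl)).
(** A factor 2 comes from squaring the sum [d], another [2 / c] from the acceptance test, and
    [1 / pmin] from the averaging. *)
Let M := 4 / (pmin * c).

Let pmin_gt0 : 0 < pmin. Proof. by case/andP: pmin01. Qed.

(** Finiteness comes from [Rs0] at the start and afterwards from the acceptance test, which excludes
    [+oo]. *)
Let hE k : h (X k, Y k) = (f k)%:E.
Proof.
rewrite fineK // fin_numE h_proper.1 /=.
case: k => [|k]; first by rewrite -Rs0.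
by move: (descent k); case: (h _).
Qed.

Let descent' k : f k.+1 <= Rs k -
  c / 2 * (fnorm (X k.+1 - X k) ^+ 2 + fnorm (Y k.+1 - Y k) ^+ 2).
Proof. by have := descent k; rewrite hE -EFinB lee_fin; lra. Qed.

Let RsS' k : Rs k.+1 = (1 - p k.+1) * Rs k + p k.+1 * f k.+1.
Proof. by have := RsS k; rewrite hE -EFinM -EFinD => -[]. Qed.

Let d_ge0 k : 0 <= d k.
Proof. by rewrite addr_ge0. Qed.

Let sqr_d_le k : d k ^+ 2 <=
  2 * (fnorm (X k.+1 - X k) ^+ 2 + fnorm (Y k.+1 - Y k) ^+ 2).
Proof.
have := sqr_ge0 (fnorm (X k.+1 - X k) - fnorm (Y k.+1 - Y k)).
rewrite /d; lra.
Qed.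

Let f_le_Rs k : f k.+1 <= Rs k.
Proof.
have := descent' k.
have : 0 <= c / 2 * (fnorm (X k.+1 - X k) ^+ 2 + fnorm (Y k.+1 - Y k) ^+ 2).
  by rewrite mulr_ge0 ?addr_ge0 ?sqr_ge0 // divr_ge0 // ltW.
lra.
Qed.

Let Rs_gap k : pmin * (Rs k - f k.+1) <= Rs k - Rs k.+1.
Proof.
have -> : Rs k - Rs k.+1 = p k.+1 * (Rs k - f k.+1) by rewrite RsS'; ring.
by rewrite ler_wpM2r ?subr_ge0 //; case/andP: (p_range k).
Qed.

Let sqr_d k : d k ^+ 2 <= M * (Rs k - Rs k.+1).
Proof.
apply: le_trans (sqr_d_le k) _; rewrite /M.
have h1 : pmin * (c / 2 * (fnorm (X k.+1 - X k) ^+ 2 + fnorm (Y k.+1 - Y k) ^+ 2))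
   <= Rs k - Rs k.+1.
  by apply: le_trans (Rs_gap k); rewrite ler_pM2l //; have := descent' k; lra.
rewrite mulrAC ler_pdivlMr ?mulr_gt0 //; lra.
Qed.

Let Rs_dec k : Rs k.+1 <= Rs k.
Proof.
have h1 : 0 <= pmin * (Rs k - f k.+1) by rewrite mulr_ge0 ?subr_ge0 // ltW.
by have := le_trans h1 (Rs_gap k); rewrite subr_ge0.
Qed.

Let f_le_Rs_same k : f k <= Rs k.
Proof.
case: k => [|k]; first by have [->] : (Rs 0%N)%:E = (f 0%N)%:E by rewrite Rs0 hE.
rewrite RsS'; have := f_le_Rs k; have /andP[_ p1] := p_range k.
rewrite -subr_ge0 => hk.
have := mulr_ge0 (_ : 0 <= 1 - p k.+1) hk; rewrite subr_ge0 => /(_ p1); lra.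
Qed.

Let Rs_le0 k : Rs k <= Rs 0%N.
Proof. by elim: k => // k; exact: le_trans. Qed.

Let e_cvg : e @ \oo --> 0.
Proof.
rewrite -[X in _ --> X](addr0 0).
by apply: cvgD; apply: fnorm_cvg0.
Qed.

Let e_le k : e k <= e k.+1 + d k.
Proof.
have tri (A B C : 'M[R]_(n, r)) : fnorm (A - C) <= fnorm (B - C) + fnorm (B - A).
  rewrite [leRHS]addrC (fnormBC B A).
  have -> : A - C = (A - B) + (B - C) by rewrite addrA subrK.
  exact: fnormD.
have := tri (X k) (X k.+1) Xl; have := tri (Y k) (Y k.+1) Yl; rewrite /e /d; lra.
Qed.

Let d_le k : d k <= e k + e k.+1.
Proof.
have tri (A B C : 'M[R]_(n, r)) : fnorm (B - A) <= fnorm (A - C) + fnorm (B - C).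
  rewrite [leRHS]addrC.
  have -> : B - A = (B - C) - (A - C) by rewrite opprB addrA subrK.
  exact: fnormB.
have := tri (X k) (X k.+1) Xl; have := tri (Y k) (Y k.+1) Yl; rewrite /e /d; lra.
Qed.

Let d_cvg : d @ \oo --> 0.
Proof.
have eS : (fun k => e k.+1) @ \oo --> 0 by rewrite (cvg_shiftS e).
have ee : (fun k => e k + e k.+1) @ \oo --> 0.
  by rewrite -[X in _ --> X](addr0 0); exact: cvgD.
apply: squeeze_cvgr (cvg_cst 0) ee; near=> k.
by rewrite d_ge0 d_le.
Unshelve. all: by end_near. Qed.

Let W_cvg : (fun k => (X k, Y k)) @ \oo --> (Xl, Yl).
Proof. exact: (cvg_pair X_cvg Y_cvg). Qed.

(** All values are at most [Rs 0], and lower semicontinuity passes this bound to the limit. *)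
Let hlE : h (Xl, Yl) = fl%:E.
Proof.
rewrite fineK // fin_numE h_proper.1 /=; apply/eqP => hoo.
have [|V VW hV] := h_lsc (x := (Xl, Yl)) (a := Rs 0%N); first by rewrite hoo ltry.
have [N _ HN] : \forall k \near \oo, V (X k, Y k) by exact: W_cvg.
have := hV _ (HN N (leqnn N)); rewrite hE lte_fin ltNge.
by rewrite (le_trans (f_le_Rs_same N) (Rs_le0 N)).
Qed.

Let f_liminf eps : 0 < eps -> \forall k \near \oo, fl - eps < f k.
Proof.
move=> eps0.
have [|V VW hV] := h_lsc (x := (Xl, Yl)) (a := fl - eps).
  by rewrite hlE lte_fin; lra.
have : \forall k \near \oo, V (X k, Y k) by exact: W_cvg.
by apply: filterS => k Vk; have := hV _ Vk; rewrite hE lte_fin.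
Qed.

(** The upper counterpart of [f_liminf]: the proximal inequality is tested at the limit point, and
    its error terms vanish with [d] and [e]. *)
Let f_limsup k : f k.+1 <= fl + (K * d k * e k.+1 + K * e k.+1 ^+ 2).
Proof.
have [G hG /(_ (Xl, Yl))] := subgrad k; rewrite hE hlE -EFinD lee_fin.
set D := (Xl, Yl) - _.
have hD : fnorm D.1 + fnorm D.2 = e k.+1.
  by rewrite /D /= /e (fnormBC Xl) (fnormBC Yl).
have pD : pnorm D ^+ 2 <= e k.+1 ^+ 2.
  rewrite ler_pXn2r ?nnegrE ?sqrtr_ge0 -?hD ?addr_ge0 //; exact: pnorm_le.
have := pdot_ge G D; rewrite hD.
have e0 : 0 <= e k.+1 by rewrite addr_ge0.
have := ler_wpM2r e0 hG; have := ler_wpM2l K0 pD; rewrite -/(d k); lra.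
Qed.

Let Rs_lb : exists m, forall k, m <= Rs k.
Proof.
have [N _ HN] := f_liminf ltr01.
exists (fl - 1) => k; apply: (@le_trans _ _ (Rs (k + N)%N)).
  by apply: le_trans (f_le_Rs_same _); apply: ltW; apply: HN; exact: leq_addl.
by elim: N {HN} => [|N IH]; rewrite ?addn0 // addnS; exact: le_trans IH.
Qed.

(** [Rs] is nonincreasing and bounded below. [Rs_gap] squeezes [f k.+1] between sequences with the
    same limit, which the two one-sided bounds identify as [fl]. *)
Let Rs_cvg : Rs @ \oo --> fl.
Proof.
have Rcv : cvgn Rs.
  apply: nonincreasing_is_cvgn; first by apply/nonincreasing_seqP.
  by have [m hm] := Rs_lb; exists m => _ [k _ <-].
set l := limn Rs; have Rl : Rs @ \oo --> l by exact: Rcv.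
have RSl : (fun k => Rs k.+1) @ \oo --> l by rewrite (cvg_shiftS Rs).
have fS : (fun k => f k.+1) @ \oo --> l.
  have lo : (fun k => Rs k - (Rs k - Rs k.+1) / pmin) @ \oo --> l - (l - l) / pmin.
    by apply: cvgB => //; apply: cvgM; [exact: cvgB|exact: cvg_cst].
  rewrite subrr mul0r subr0 in lo.
  apply: squeeze_cvgr lo Rl; near=> k; rewrite /= f_le_Rs andbT.
  by rewrite lerBlDr -lerBlDl ler_pdivlMr // mulrC Rs_gap.
suff -> : fl = l by [].
apply/eqP; rewrite eq_le; apply/andP; split.
  apply/ler_addgt0Pr => eps eps0; rewrite -lerBlDr.
  apply: (cvgr_to_ge fS).
  have [N _ HN] := f_liminf eps0; exists N => // k Nk.
  by apply: ltW; apply: HN; exact: leqW.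
have up : (fun k => fl + (K * d k * e k.+1 + K * e k.+1 ^+ 2)) @ \oo
    --> fl + (K * 0 * 0 + K * 0 ^+ 2).
  have eS : (fun k => e k.+1) @ \oo --> 0 by rewrite (cvg_shiftS e).
  apply: cvgD; first exact: cvg_cst.
  apply: cvgD; first by apply: cvgM => //; apply: cvgM => //; exact: cvg_cst.
  by apply: cvgM; [exact: cvg_cst|rewrite expr2; apply: cvgM].
rewrite expr0n !mulr0 !addr0 in up.
rewrite -subr_ge0; apply: (cvgr_to_ge (cvgB up fS)); near=> k.
by rewrite subr_ge0.
Unshelve. all: by end_near. Qed.

Let f_cvg : f @ \oo --> fl.
Proof.
rewrite -(cvg_shiftS f).
have RS : (fun k => Rs k.+1) @ \oo --> fl by rewrite (cvg_shiftS Rs).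
have lo : (fun k => Rs k - (Rs k - Rs k.+1) / pmin) @ \oo --> fl - (fl - fl) / pmin.
  by apply: cvgB => //; apply: cvgM; [exact: cvgB|exact: cvg_cst].
rewrite subrr mul0r subr0 in lo.
apply: squeeze_cvgr lo Rs_cvg; near=> k; rewrite /= f_le_Rs andbT.
by rewrite lerBlDr -lerBlDl ler_pdivlMr // mulrC Rs_gap.
Unshelve. all: by end_near. Qed.

(** The KL property is assumed only where the subdifferential is nonempty; here 0 is a limiting
    subgradient, because the step lengths tend to 0. *)
Let limit_critical : limiting_subdiff h (Xl, Yl) !=set0.
Proof.
have [G hG] : {G : nat -> E & forall k, pnorm (G k) <= K * d k /\
    prox_subgrad2 K h (X k.+1, Y k.+1) (G k)}.
  apply: (@choice _ _ (fun k G => pnorm G <= K * d k /\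
    prox_subgrad2 K h (X k.+1, Y k.+1) G)) => k.
  by have [G ? ?] := subgrad k; exists G.
exists 0; split; first by rewrite hlE.
exists (fun k => (X k.+1, Y k.+1)), G; split.
- have XS : (fun k => X k.+1) @ \oo --> Xl by rewrite (cvg_shiftS X).
  have YS : (fun k => Y k.+1) @ \oo --> Yl by rewrite (cvg_shiftS Y).
  exact: (cvg_pair XS YS).
- rewrite hlE; under eq_cvg do rewrite /= hE.
  by apply/cvg_EFin; [near=> k|rewrite (cvg_shiftS f)].
- have Kd : (fun k => K * d k) @ \oo --> K * 0.
    by apply: cvgM => //; exact: cvg_cst.
  rewrite mulr0 in Kd; apply/cvgr0Pnorm_lt => eps eps0; near=> k.
  apply: le_lt_trans (norm_le_pnorm _) _; have [hk _] := hG k.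
  by apply: le_lt_trans hk _; near: k; exact: cvgr_lt Kd _ eps0.
- move=> k; have [_ hk] := hG k.
  by apply: prox_subgrad2_frechet hk; rewrite ?hE.
Unshelve. all: by end_near. Qed.

Lemma nonmonotone_descent_rate :
  (theta <= 1 / 2 -> exists d1 varrho : R, [/\ 0 < d1, 0 < varrho < 1 &
     \forall k \near \oo, fnorm (X k - Xl) + fnorm (Y k - Yl) <= d1 * varrho ^+ k]) /\
  (1 / 2 < theta -> exists2 d2 : R, 0 < d2 & \forall k \near \oo,
     fnorm (X k - Xl) + fnorm (Y k - Yl)
       <= d2 * k%:R `^ (- ((1 - theta) / (2 * theta - 1)))).
Proof.
have [V [nu [L [VW nu0 L0 HL]]]] : exists (V : set E) (nu K' : R),
    [/\ nbhs (Xl, Yl) V, 0 < nu, 0 <= K' & forall W' (t : R), V W' -> h W' = t%:E -> fl < t < fl + nu ->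
    forall G, limiting_subdiff h W' G -> (t - fl) `^ theta <= K' * pnorm G].
  by apply: KL_exponent_bound => //; [rewrite hlE|exact: h_KL].
have Rs_ge k : fl <= Rs k.
  by rewrite -(cvg_lim _ Rs_cvg) //; apply: nonincreasing_cvgn_ge;
    [apply/nonincreasing_seqP|exact: cvgP Rs_cvg].
pose rr k := Rs k - fl.
have rr0 k : 0 <= rr k by rewrite subr_ge0.
have rrD k : rr k - rr k.+1 = Rs k - Rs k.+1 by rewrite /rr; ring.
have rr_dec k : rr k.+1 <= rr k by rewrite lerD2r.
(* The gap is taken at [k] but the KL inequality at [k.+1], where the subgradient is available. *)
have [N HN] : exists N, forall k, (N <= k)%N ->
    [/\ rr k <= 1, V (X k.+1, Y k.+1) & f k.+1 < fl + nu].
  have Vk : \forall k \near \oo, V (X k, Y k) by exact: W_cvg.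
  have fk : \forall k \near \oo, f k < fl + nu.
    by apply: cvgr_lt f_cvg _ _; rewrite ltrDl.
  have Rk : \forall k \near \oo, Rs k < fl + 1.
    by apply: cvgr_lt Rs_cvg _ _; rewrite ltrDl.
  have [N _ H] := filterI Vk (filterI fk Rk).
  exists N => k Nk; have [_ [_ h3]] := H k Nk.
  have [h1 [h2 _]] := H k.+1 (leqW Nk); split => //.
  by rewrite lerBlDr addrC ltW.
(* A common constant for the KL recursion and for the bound on squared steps. *)
pose C := 4 * (L * K) ^+ 2 * M + 2 / pmin + M.
have M0 : 0 < M by rewrite divr_gt0 // mulr_gt0.
have LK : 0 <= L * K by rewrite mulr_ge0.
have LKM : 0 <= 4 * (L * K) ^+ 2 * M.
  by rewrite mulr_ge0 ?(ltW M0) // mulr_ge0 // sqr_ge0.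
have pm2 : 0 <= 2 / pmin by rewrite divr_ge0 // ltW.
have C0 : 0 < C by rewrite /C; lra.
have sqr_dC k : d k ^+ 2 <= C * (rr k - rr k.+1).
  apply: le_trans (sqr_d k) _; rewrite rrD ler_wpM2r ?subr_ge0 // /C; lra.
have KLC theta1 k : theta <= theta1 -> 1 / 2 <= theta1 < 1 -> (N <= k)%N ->
    rr k `^ (2 * theta1) <= C * (rr k - rr k.+1).
  move=> t1 t2 Nk; have [rk1 Vk fk] := HN k Nk.
  apply: (@le_trans _ _ ((4 * (L * K) ^+ 2 * M + 2 / pmin) * (rr k - rr k.+1))); last first.
    by rewrite ler_wpM2r ?subr_ge0 // /C lerDl ltW.
  apply: (@KL_gap_bound _ (f k.+1 - fl) _ _ _ theta) => //.
  - by case/andP: theta01 => -> _ /=.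
  - by case/andP: pmin01 => -> /ltW ->.
  - by rewrite rr0 rr_dec.
  - exact: ltW.
  - by rewrite lerD2r.
  - have -> : rr k - (f k.+1 - fl) = Rs k - f k.+1 by rewrite /rr; ring.
    by rewrite ler_pdivlMr // rrD mulrC.
  - move=> fpos; exists (d k); last by rewrite rrD.
    have [G hG pG] := subgrad k.
    have := HL _ _ Vk (hE _); rewrite -subr_gt0 fpos fk => /(_ isT G).
    have hGl : limiting_subdiff h (X k.+1, Y k.+1) G.
      apply: frechet_subdiff_limiting; apply: prox_subgrad2_frechet pG => //.
      by rewrite hE.
    move=> /(_ hGl) hh; apply: le_trans hh _.
    by rewrite -mulrA ler_wpM2l.
split=> ht.
  (* Exponents below 1/2 are raised to 1/2, which is allowed since the gap is at most 1. *)
  apply: (@linear_rate _ e d rr N (1 / 2) C) => //; try lra.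
  by move=> k Nk; apply: KLC => //; lra.
apply: (@sublinear_rate _ e d rr N theta C) => //; first by lra.
  by case/andP: theta01.
move=> k Nk; apply: KLC => //; case/andP: theta01 => _ ->; rewrite andbT ltW //.
Qed.

End NonmonotoneDescent.

(** * Application to the algorithm *)

Lemma cvg_fnorm_bounded (R : realType) m n
    (X : nat -> 'M[R]_(m, n)) (L : 'M[R]_(m, n)) :
  X @ \oo --> L -> exists2 B, 0 <= B & forall k, fnorm (X k) <= B.
Proof.
move=> /cvgP /cvg_seq_bounded /pinfty_ex_gt0[B B0 XB].
exists (((m * n)%:R + 1) * B); first by rewrite mulr_ge0 ?addr_ge0 // ltW.
move=> k; apply: le_trans (fnorm_le_mx_norm _) _.
by rewrite ler_wpM2l ?addr_ge0 //; exact: XB.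
Qed.

Theorem theorem5p4 (R : realType) (n r q : nat) (hr : (r <= n)%N)
  (hq : (q <= n ^ 2)%N)
  (Psi Phi : 'M[R]_(n, r) -> \bar R)
  (A : {linear 'M[R]_n -> 'cV[R]_q}) (As : {linear 'cV[R]_q -> 'M[R]_n})
  (hAs : is_adjoint A As)
  (b : 'cV[R]_q) (lambda : R) (hlambda : 0 <= lambda)
  (hPsi : regular_penalty Psi) (hPhi : regular_penalty Phi)
  (hAAs : forall v, A (As v) = v)
  (alpha beta : R) (halpha : alpha != 0) (hbeta : beta != 0)
  (halphabeta : alpha^-1 + beta^-1 = 1)
  (hlevel : lambda = 0 -> level_bounded (Fobj Psi Phi A b 0))
  (mumin sigmin sigmax tau c pmin gamma : R)
  (hmumin : 0 < mumin) (hsigmin : 0 < sigmin) (hsigmax : sigmin < sigmax)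
  (htau : 1 < tau) (hc : 0 < c) (hpmin : 0 < pmin < 1)
  (hgamma : 0 <= gamma)
  (hpsd : psd_op (fun M => (alpha + gamma) *: M + beta *: As (A M)))
  (theta : R) (htheta : 0 <= theta < 1)
  (hKL : KL_function_exponent (Fobj Psi Phi A b lambda) theta)
  (X Y : nat -> 'M[R]_(n, r))
  (hdom : (Fobj Psi Phi A b lambda (X 0%N, Y 0%N) < +oo)%E)
  (hseq : ANAUM_sequence Psi Phi A As b lambda alpha beta
            mumin sigmin sigmax tau c pmin gamma X Y)
  (Xlim Ylim : 'M[R]_(n, r))
  (hX : X @ \oo --> Xlim) (hY : Y @ \oo --> Ylim) :
  (theta <= 1 / 2 ->
     exists d1 varrho : R, [/\ 0 < d1, 0 < varrho < 1 &
       \forall k \near \oo,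
         fnorm (X k - Xlim) + fnorm (Y k - Ylim) <= d1 * varrho ^+ k]) /\
  (1 / 2 < theta ->
     exists2 d2 : R, 0 < d2 &
       \forall k \near \oo,
         fnorm (X k - Xlim) + fnorm (Y k - Ylim)
           <= d2 * k%:R `^ (- ((1 - theta) / (2 * theta - 1)))).
Proof.
have [hprop hlsc hKLx] := hKL.
have [BX BX0 hBX] := cvg_fnorm_bounded hX.
have [BY BY0 hBY] := cvg_fnorm_bounded hY.
(* Convergent sequences are bounded; a joint bound on both blocks yields one [K] for all
   iterations. *)
have [K K0 hK] := ANAUM_step_prox_subgrad Psi Phi b sigmax (lambda := lambda)
  (sigmin := sigmin) hAs hAAs halpha hbeta halphabeta hgamma hc hmumin
  hsigmin htau hpsd hlambda (addr_ge0 BX0 BY0).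
have XB k : fnorm (X k) <= BX + BY by apply: le_trans (hBX k) _; rewrite lerDl.
have YB k : fnorm (Y k) <= BX + BY by apply: le_trans (hBY k) _; rewrite lerDr.
have [Rs [p [Rs0 hstep]]] := hseq.
apply: (nonmonotone_descent_rate (h := Fobj Psi Phi A b lambda) (Rs := Rs) (p := p)
  (c := c) (pmin := pmin) (K := K)) => //.
- by move=> k; have [/ANAUM_step_accept] := hstep k.
- by move=> k; have [] := hstep k.
- by move=> k; have [] := hstep k.
- by move=> k; have [step _ _] := hstep k; apply: hK step.
Qed.
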